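(* Algorithm 1 (written out in the context) decides whether a given finite set of transactions $\mathcal{T}$ is robust against RC, i.e. it returns True if and only if $\mathcal{T}$ is robust against RC, and it runs in time $O(\max\{k\cdot|\mathcal{T}|^3,\;k^3\cdot\ell\})$, where $k$ is the total number of operations in $\mathcal{T}$ and $\ell$ is the maximum number of operations in a transaction in $\mathcal{T}$.
   Context: **Tuples and operations.** A relational schema is a set $\mathsf{Rels}$ of relation names; each $R\in\mathsf{Rels}$ has a finite attribute set $\mathrm{Attr}(R)$ and an infinite set $\mathbf{Tuples}_R$ of abstract objects (tuples of type $R$), pairwise disjoint for different $R$; $\mathbf{Tuples}=\bigcup_R \mathbf{Tuples}_R$. On a tuple $t$ there are three kinds of operations: $\mathtt{R}[t]$ (read), $\mathtt{W}[t]$ (write), $\mathtt{U}[t]$ (atomic update: a read followed by a write, as a single atomic operation). A *read operation* is an $\mathtt{R}$- or $\mathtt{U}$-operation; a *write operation* is a $\mathtt{W}$- or $\mathtt{U}$-operation. Each operation $o$ on a tuple of type $R$ has sets $\mathrm{ReadSet}(o),\mathrm{WriteSet}(o)\subseteq \mathrm{Attr}(R)$, with $\mathrm{WriteSet}(o)=\emptyset$ for $\mathtt{R}$-operations and $\mathrm{ReadSet}(o)=\emptyset$ for $\mathtt{W}$-operations. There is also a commit operation $\mathtt{C}$. **Transactions.** A transaction $T$ is a finite sequence (linear order $\le_T$, strict version $<_T$) of read and write operations followed by a commit. A transaction performs at most one $\mathtt R$-, one $\mathtt W$- and one $\mathtt U$-operation per tuple. In a set $\mathcal{T}$ of transactions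 each transaction $T_i$ has a unique id $i$; operations of different transactions are distinct; $\mathtt{C}_i$ is the commit of $T_i$. **Schedules.** A (multiversion) schedule $s$ over $\mathcal{T}$ is a tuple $(O_s,\le_s,\ll_s,v_s)$: $O_s$ consists of all operations of transactions in $\mathcal{T}$ and a special operation $op_0$ (writing the initial versions of all tuples); $\le_s$ is a total order on $O_s$; $\ll_s$ (version order) gives for each tuple $t$ a total order on the write operations on $t$ in $s$; $v_s$ (version function) maps each read operation $a$ to $op_0$ or to a write operation different from $a$. Required: $op_0\le_s a$ for all $a\in O_s$; $op_0\ll_s a$ for every write operation $a$; $a<_T b$ implies $a<_s b$ for all $T\in\mathcal{T}$; for each read operation $a$, $v_s(a)<_s a$, and if $v_s(a)\neq op_0$ then $v_s(a)$ is on the same tuple as $a$. $s$ is a *single version schedule* if for all write operations $a,b$ on the same tuple $a\ll_s b$ iff $a<_s b$, and for every read operation $a$ there is no write operation $c$ on the same tuple with $v_s(a)<_s c<_s a$. It is *single version serial* if moreover $a<_s b<_s c$ with $a,c\in T$ implies $b\in T$, for all $T\in\mathcal{T}$. **Conflicts and serializability.** For operations $x,y$ on the same tuple from different transactions: $x$ is *ww-conflicting* with $y$ if $\mathrm{WriteSet}(x)\cap\mathrm{WriteSet}(y)\ne\emptyset$; *wr-conflicting* with $y$ if $\mathrm{WriteSet}(x)\cap\mathrm{ReadSet}(y)\neq\emptyset$; *rw-conflicting* with $y$ if $\mathrm{ReadSet}(x)\cap\mathrm{WriteSet}(y)\ne\emptyset$; *conflicting* if at least one of these holds. Commits and $op_0$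 conflict with nothing. For conflicting $b_i\in T_i$, $a_j\in T_j$, write $b_i\to_s a_j$ if: $b_i$ is ww-conflicting with $a_j$ and $b_i\ll_s a_j$; or $b_i$ is wr-conflicting with $a_j$ and ($b_i=v_s(a_j)$ or $b_i\ll_s v_s(a_j)$); or $b_i$ is rw-conflicting with $a_j$ and $v_s(b_i)\ll_s a_j$. Two schedules $s,s'$ over the same $\mathcal{T}$ are *conflict equivalent* if for all conflicting $a_j,b_i$: $b_i\to_s a_j$ iff $b_i\to_{s'}a_j$. $s$ is *conflict serializable* if it is conflict equivalent to a single version serial schedule. **RC and robustness.** $s$ *exhibits a dirty write* if there are ww-conflicting $b_i\in T_i$, $a_j\in T_j$, $T_i\ne T_j$, with $b_i<_s a_j<_s\mathtt{C}_i$. $\ll_s$ *corresponds to the commit order* if for all write operations $b_i\in T_i$, $a_j\in T_j$ on the same tuple with $T_i\neq T_j$: $b_i\ll_s a_j$ iff $\mathtt{C}_i<_s\mathtt{C}_j$. $s$ is *read-last-committed* if $\ll_s$ corresponds to the commit order and for every read operation $a_j$ on a tuple $t$: (i) $v_s(a_j)=op_0$, or $v_s(a_j)\in T_i$ with $\mathtt{C}_i<_s a_j$; and (ii) there is no write operation $c_k\in T_k$ on $t$ with $\mathtt{C}_k<_s a_j$ and $v_s(a_j)\ll_s c_k$. $s$ is *allowed under RC* (multiversion read committed) if it is read-last-committed and exhibits no dirty write. $\mathcal{T}$ is *robust against RC* if every schedule over $\mathcal{T}$ allowed under RC is conflict serializable. **Prefix-conflict-free graph.** For a transaction $T_1$,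 $b_1\in T_1$, let $\mathsf{prefix}_{b_1}(T_1)$ be the restriction of $T_1$ to operations $\le_{T_1}b_1$. For a set $\mathcal{T}'$ of transactions with $T_1\notin\mathcal{T}'$, prefix-conflict-free-graph$(b_1,T_1,\mathcal{T}')$ is the graph whose nodes are the transactions in $\mathcal{T}'$ having no operation that is ww-conflicting with an operation in $\mathsf{prefix}_{b_1}(T_1)$, with an edge between $T_i$ and $T_j$ if $T_i$ has an operation conflicting with an operation in $T_j$. **Algorithm 1.** Input: $\mathcal{T}$. For each $T_1\in\mathcal{T}$ and each read operation $b_1$ in $T_1$: let $G$ be prefix-conflict-free-graph$(b_1,T_1,\mathcal{T}\setminus\{T_1\})$ and let $TC$ be the reflexive-transitive closure of $G$; for each $(T_2,T_m)$ in $TC$ and all $a_1\in T_1$, $a_2\in T_2$, $b_m\in T_m$: if $a_1$ conflicts with $b_m$, and $b_1$ is rw-conflicting with $a_2$, and ($b_1<_{T_1}a_1$ or $b_m$ is rw-conflicting with $a_1$), return False. If no iteration returned False, return True. **Cost convention.** Testing whether two given operations are (ww-, wr-, rw-)conflicting, and comparing the positions of two operations in a transaction, are counted as unit-time steps. *)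

(* Defs.v *)
From HB Require Import structures.
From mathcomp Require Import all_boot finmap.

Set Implicit Arguments.
Unset Strict Implicit.
Unset Printing Implicit Defensive.

Local Open Scope fset_scope.

(* Attribute names live in one ambient type, so that the attribute sets of two
   operations on the same tuple can be intersected without transport. *)
Record schema := Schema {
  attribute : choiceType;
  Rel : eqType;
  Attr : Rel -> {fset attribute};
  Tup : Rel -> eqType;
  Tup_infinite : forall (R : Rel) (s : seq (Tup R)), exists t, t \notin s
}.

(* The dependent sum makes the tuple sets of different relations disjoint. *)
Definition dbtuple (S : schema) : eqType := {R : Rel S & Tup R}.

Inductive kind := KRead | KWrite | KUpdate.

Definition kind_code (k : kind) : nat :=
  match k with KRead => 0 | KWrite => 1 | KUpdate => 2 end.
Definition kind_decode (n : nat) : kind :=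
  match n with 0 => KRead | 1 => KWrite | _ => KUpdate end.
Lemma kind_codeK : cancel kind_code kind_decode. Proof. by case. Qed.
HB.instance Definition _ := Equality.copy kind (can_type kind_codeK).

Definition kreads (k : kind) : bool := k != KWrite.
Definition kwrites (k : kind) : bool := k != KRead.

Record action (S : schema) := Action {
  akind : kind;
  atup : dbtuple S;
  rset : {fset attribute S};
  wset : {fset attribute S};
  rset_attr : rset `<=` Attr (tag atup);
  wset_attr : wset `<=` Attr (tag atup);
  rset_write : akind = KWrite -> rset = fset0;
  wset_read : akind = KRead -> wset = fset0
}.

(* The final commit is implicit: it is added by [operation] below and counted
   by [num_ops] and [max_ops]. *)
Record transaction (S : schema) := Transaction {
  actions : seq (action S);
  once_per_tuple : uniq [seq (akind a, atup a) | a <- actions]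
}.

Section Schedules.

Variables (S : schema) (T : seq (transaction S)).

(* Transactions are identified by their index in [T], and the read and write
   operations by a transaction and a position in it; hence syntactically equal
   transactions of [T] have distinct operations. *)
Definition txid := 'I_(size T).
Definition pos (i : txid) := 'I_(size (actions (tnth (in_tuple T) i))).
Definition occ := {i : txid & pos i}.

Definition tx (x : occ) : txid := tag x.
Definition rank (x : occ) : nat := tagged x.
Definition act (x : occ) : action S :=
  tnth (in_tuple (actions (tnth (in_tuple T) (tag x)))) (tagged x).

Definition tup (x : occ) : dbtuple S := atup (act x).
Definition is_read (x : occ) : bool := kreads (akind (act x)).
Definition is_write (x : occ) : bool := kwrites (akind (act x)).
Definition ReadSet (x : occ) : {fset attribute S} := rset (act x).
Definition WriteSet (x : occ) : {fset attribute S} := wset (act x).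

Inductive operation := Op0 | Act of occ | Commit of txid.

Definition op_code (o : operation) : option (occ + txid) :=
  match o with
  | Op0 => None
  | Act x => Some (inl x)
  | Commit i => Some (inr i)
  end.
Definition op_decode (c : option (occ + txid)) : operation :=
  match c with
  | None => Op0
  | Some (inl x) => Act x
  | Some (inr i) => Commit i
  end.
Lemma op_codeK : cancel op_code op_decode. Proof. by case. Qed.
HB.instance Definition _ := Finite.copy operation (can_type op_codeK).

Definition in_tx (i : txid) (o : operation) : bool :=
  match o with
  | Op0 => false
  | Act x => tx x == i
  | Commit j => j == i
  end.

(* The union of the strict orders of all transactions. *)
Definition tx_lt : rel operation := fun a b =>
  match a, b with
  | Act x, Act y => (tx x == tx y) && (rank x < rank y)
  | Act x, Commit i => tx x == i
  | _, _ => false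
  end.

(* The operations that install a version of [t]. *)
Definition installs (t : dbtuple S) (o : operation) : bool :=
  match o with
  | Op0 => true
  | Act x => is_write x && (tup x == t)
  | Commit _ => false
  end.

Definition strict (T : eqType) (r : rel T) : rel T :=
  fun a b => (a != b) && r a b.

(* [vers_lt] is the strict version order; only its restrictions to the sets
   [installs t] are meaningful. [vfun] is only meaningful on read operations. *)
Record schedule := Schedule {
  sle : rel operation;
  vers_lt : rel operation;
  vfun : occ -> operation;
  sle_anti : antisymmetric sle;
  sle_trans : transitive sle;
  sle_total : total sle;
  vers_irr : forall t : dbtuple S,
    {in installs t, forall a, ~~ vers_lt a a};
  vers_trans : forall t : dbtuple S,
    {in installs t & installs t & installs t, forall a b c,
      vers_lt a b -> vers_lt b c -> vers_lt a c};
  vers_total : forall t : dbtuple S,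
    {in installs t & installs t, forall a b,
      a != b -> vers_lt a b || vers_lt b a};
  op0_first : forall a, sle Op0 a;
  op0_vers : forall x, is_write x -> vers_lt Op0 (Act x);
  sle_tx : forall a b, tx_lt a b -> strict sle a b;
  vfun_cod : forall x, is_read x ->
    vfun x = Op0 \/
    exists y, [/\ vfun x = Act y, is_write y, y <> x & tup y = tup x];
  vfun_lt : forall x, is_read x -> strict sle (vfun x) (Act x)
}.

Definition slt (s : schedule) : rel operation := strict (sle s).

Definition single_version (s : schedule) : Prop :=
  (forall x y, is_write x -> is_write y -> tup x = tup y ->
     vers_lt s (Act x) (Act y) <-> slt s (Act x) (Act y)) /\
  (forall x, is_read x ->
     ~ exists z, [/\ is_write z, tup z = tup x,
         slt s (vfun s x) (Act z) & slt s (Act z) (Act x)]).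

Definition single_version_serial (s : schedule) : Prop :=
  single_version s /\
  forall (i : txid) (a b c : operation),
    slt s a b -> slt s b c -> in_tx i a -> in_tx i c -> in_tx i b.

Definition may_conflict (x y : occ) : bool :=
  (tx x != tx y) && (tup x == tup y).

Definition ww_conflict (x y : occ) : bool :=
  may_conflict x y && (WriteSet x `&` WriteSet y != fset0).
Definition wr_conflict (x y : occ) : bool :=
  may_conflict x y && (WriteSet x `&` ReadSet y != fset0).
Definition rw_conflict (x y : occ) : bool :=
  may_conflict x y && (ReadSet x `&` WriteSet y != fset0).
Definition conflict (x y : occ) : bool :=
  [|| ww_conflict x y, wr_conflict x y | rw_conflict x y].

Definition depends (s : schedule) (b a : occ) : Prop :=
  [\/ ww_conflict b a /\ vers_lt s (Act b) (Act a),
      wr_conflict b a /\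
        (Act b = vfun s a \/ vers_lt s (Act b) (vfun s a))
    | rw_conflict b a /\ vers_lt s (vfun s b) (Act a)].

Definition conflict_equivalent (s s' : schedule) : Prop :=
  forall a b, conflict a b -> depends s b a <-> depends s' b a.

Definition conflict_serializable (s : schedule) : Prop :=
  exists s', single_version_serial s' /\ conflict_equivalent s s'.

Definition dirty_write (s : schedule) : Prop :=
  exists b a, [/\ ww_conflict b a,
    slt s (Act b) (Act a) & slt s (Act a) (Commit (tx b))].

Definition commit_ordered (s : schedule) : Prop :=
  forall b a, is_write b -> is_write a -> tup b = tup a -> tx b <> tx a ->
    vers_lt s (Act b) (Act a) <-> slt s (Commit (tx b)) (Commit (tx a)).

Definition read_last_committed (s : schedule) : Prop :=
  commit_ordered s /\
  forall a, is_read a ->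
    (vfun s a = Op0 \/
     exists b, vfun s a = Act b /\ slt s (Commit (tx b)) (Act a)) /\
    ~ exists c, [/\ is_write c, tup c = tup a,
        slt s (Commit (tx c)) (Act a) & vers_lt s (vfun s a) (Act c)].

Definition allowed_under_RC (s : schedule) : Prop :=
  read_last_committed s /\ ~ dirty_write s.

Definition robust_against_RC : Prop :=
  forall s : schedule, allowed_under_RC s -> conflict_serializable s.

End Schedules.

Arguments Op0 {S T}.

(* Cost model: a computation is a value together with the number of unit steps
   spent. Each [ret] and each [bind] costs one step, and so does each primitive
   test below. Everything else is written with these, on plain lists (no
   constant-time indexing), and every recursive call goes through [bind]; the
   Rocq terms under [ret] only apply a constructor or a boolean connective. *)
Definition timed (A : Type) : Type := (A * nat)%type.

Definition ret (A : Type) (a : A) : timed A := (a, 1).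

Definition bind (A B : Type) (m : timed A) (f : A -> timed B) : timed B :=
  ((f m.1).1, (m.2 + (f m.1).2).+1).

Notation "'let!' x := m 'in' f" := (bind m (fun x => f))
  (at level 200, x name, m at level 100, f at level 200,
   format "'[v' 'let!'  x  :=  m  'in' '/' f ']'").

Definition result (A : Type) (m : timed A) : A := m.1.
Definition cost (A : Type) (m : timed A) : nat := m.2.

Definition test (b : bool) : timed bool := (b, 1).

Section Loops.

Variables A B : Type.

(* Loop over a list that is left as soon as the body returns [true]. *)
Fixpoint search (f : A -> timed bool) (s : seq A) : timed bool :=
  if s is x :: s' then
    let! b := f x in if b then ret true else search f s'
  else ret false.

Fixpoint search2 (f : A -> B -> timed bool) (s : seq A) (t : seq B) :
    timed bool :=
  match s, t with
  | x :: s', y :: t' =>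
      let! b := f x y in if b then ret true else search2 f s' t'
  | _, _ => ret false
  end.

Fixpoint select (f : A -> timed bool) (s : seq A) : timed (seq A) :=
  if s is x :: s' then
    let! b := f x in
    let! r := select f s' in
    ret (if b then x :: r else r)
  else ret [::].

Fixpoint each (f : A -> timed B) (s : seq A) : timed (seq B) :=
  if s is x :: s' then
    let! y := f x in
    let! r := each f s' in
    ret (y :: r)
  else ret [::].

Fixpoint lookup (d : A) (s : seq A) (k : nat) : timed A :=
  match s, k with
  | [::], _ => ret d
  | x :: _, 0 => ret x
  | _ :: s', k'.+1 => let! y := lookup d s' k' in ret y
  end.

End Loops.

Fixpoint or_rows (r q : seq bool) : timed (seq bool) :=
  match r, q with
  | a :: r', b :: q' =>
      let! u := or_rows r' q' in
      ret ((a || b) :: u)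
  | _, _ => ret [::]
  end.

(* Warshall's transitive closure of a boolean matrix given by its rows; the
   first argument is a list with one entry per remaining pivot. *)
Definition warshall_step (M : seq (seq bool)) (k : nat) :
    timed (seq (seq bool)) :=
  let! q := lookup [::] M k in
  each (fun r => let! b := lookup false r k in
                 if b then or_rows r q else ret r) M.

Fixpoint warshall (A : Type) (pivots : seq A) (k : nat)
    (M : seq (seq bool)) : timed (seq (seq bool)) :=
  if pivots is _ :: pivots' then
    let! M' := warshall_step M k in
    warshall pivots' k.+1 M'
  else ret M.

Section Algorithm.

Variables (S : schema) (T : seq (transaction S)).

Definition test_ww (x y : occ T) : timed bool := test (ww_conflict x y).
Definition test_rw (x y : occ T) : timed bool := test (rw_conflict x y).
Definition test_conflict (x y : occ T) : timed bool := test (conflict x y).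
Definition test_read (x : occ T) : timed bool := test (is_read x).
Definition test_same (i j : txid T) : timed bool := test (i == j).

(* Positions in one transaction; only applied to [x], [y] with
   [tx x = tx y]. *)
Definition test_before (x y : occ T) : timed bool := test (rank x < rank y).
Definition test_before_eq (x y : occ T) : timed bool := test (rank x <= rank y).

(* A transaction as input data: its id and the list of its read and write
   operations in program order; the commit is left out, since it conflicts with
   nothing. *)
Definition tx_data : Type := (txid T * seq (occ T))%type.

Definition tx_ops (i : txid T) : seq (occ T) :=
  [seq Tagged (@pos S T) p | p <- enum {: pos i}].

Definition input : seq tx_data := [seq (i, tx_ops i) | i <- enum {: txid T}].

Definition has_ww (P Q : seq (occ T)) : timed bool :=
  search (fun x => search (fun y => test_ww x y) Q) P.

Definition has_conflict (P Q : seq (occ T)) : timed bool :=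
  search (fun x => search (fun y => test_conflict x y) Q) P.

(* Nodes of prefix-conflict-free-graph(b1, T1, T \ {T1}). *)
Definition pcf_nodes (b1 : occ T) (t1 : tx_data) (ts : seq tx_data) :
    timed (seq tx_data) :=
  let! prefix := select (fun x => test_before_eq x b1) t1.2 in
  select (fun t =>
    let! e := test_same t.1 t1.1 in
    if e then ret false else
    let! w := has_ww t.2 prefix in
    ret (~~ w)) ts.

(* Adjacency matrix of the reflexive closure of the graph. *)
Definition pcf_matrix (nodes : seq tx_data) : timed (seq (seq bool)) :=
  each (fun t => each (fun u =>
    let! e := test_same t.1 u.1 in
    if e then ret true else has_conflict t.2 u.2) nodes) nodes.

Definition check_ops (b1 a1 a2 bm : occ T) : timed bool :=
  let! c := test_conflict a1 bm in
  let! d := test_rw b1 a2 in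
  let! e := test_before b1 a1 in
  let! f := test_rw bm a1 in
  ret [&& c, d & e || f].

Definition check_split (b1 : occ T) (t1 : tx_data) (ts : seq tx_data) :
    timed bool :=
  let! nodes := pcf_nodes b1 t1 ts in
  let! M := pcf_matrix nodes in
  let! TC := warshall nodes 0 M in
  search2 (fun t2 row => search2 (fun tm (reach : bool) =>
    if reach then
      search (fun a1 =>
        search (fun a2 =>
          search (fun bm => check_ops b1 a1 a2 bm) tm.2) t2.2) t1.2
    else ret false) nodes row) nodes TC.

Definition algorithm1 : timed bool :=
  let! found :=
    search (fun t1 =>
      search (fun b1 =>
        let! r := test_read b1 in
        if r then check_split b1 t1 input else ret false) t1.2) input in
  ret (~~ found).

End Algorithm.

Definition num_ops (S : schema) (T : seq (transaction S)) : nat :=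
  \sum_(t <- T) (size (actions t)).+1.

Definition max_ops (S : schema) (T : seq (transaction S)) : nat :=
  \max_(t <- T) (size (actions t)).+1.

(* Main.v *)
Require Import Defs.
From mathcomp Require Import all_boot finmap zify.

(** If the algorithm finds a pattern T1, T2, ..., Tm, run the prefix of T1 up to
    b1, then T2, ..., Tm along a simple path of the graph, then the rest of T1
    and the remaining transactions: this schedule is allowed under RC, and its
    dependencies contain the cycle T1 -> T2 -> ... -> Tm -> T1.

    Conversely, a schedule whose dependencies are acyclic is equivalent to any
    serial schedule that extends them.  If there is a cycle, take one of minimal
    length, let T2 be the transaction in it that commits first and T1 its
    predecessor.  Under RC, a dependency against the commit order is an
    rw-conflict whose read precedes the commit of the writer; so T1 reads in b1
    before any other transaction of the cycle commits.  A transaction of the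
    cycle with a ww-conflict with the prefix of T1 up to b1 then has to write
    after T1 commits, hence depends on T1, which gives a shorter cycle.  So all
    transactions of the cycle but T1 are nodes of the graph. *)

Set Implicit Arguments.
Unset Strict Implicit.
Unset Printing Implicit Defensive.

(** * Conflicts and dependencies *)

Section Conflicts.

Variables (S : schema) (T : seq (transaction S)).
Implicit Types (x y a b : occ T) (i j : txid T).

Lemma occ_inj x y : tx x = tx y -> rank x = rank y -> x = y.
Proof.
case: x y => i a [j b]; rewrite /tx /rank /= => e; case: _ / e b => b e.
by congr existT; apply: val_inj.
Qed.

Lemma may_conflictC x y : may_conflict x y = may_conflict y x.
Proof. by rewrite /may_conflict eq_sym [tup x == _]eq_sym. Qed.

Lemma ww_conflictC x y : ww_conflict x y = ww_conflict y x.
Proof. by rewrite /ww_conflict may_conflictC fsetIC. Qed.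

Lemma wr_rw_conflict x y : wr_conflict x y = rw_conflict y x.
Proof. by rewrite /wr_conflict /rw_conflict may_conflictC fsetIC. Qed.

Lemma conflictC x y : conflict x y = conflict y x.
Proof.
by rewrite /conflict ww_conflictC !wr_rw_conflict; congr orb; rewrite orbC.
Qed.

Lemma ReadSet_is_read x A : (ReadSet x `&` A != fset0)%fset -> is_read x.
Proof.
move=> h; rewrite /is_read /kreads; apply: contra h => /eqP k.
by rewrite /ReadSet rset_write // fset0I.
Qed.

Lemma WriteSet_is_write x A : (WriteSet x `&` A != fset0)%fset -> is_write x.
Proof.
move=> h; rewrite /is_write /kwrites; apply: contra h => /eqP k.
by rewrite /WriteSet wset_read // fset0I.
Qed.

Lemma ww_conflictP x y : ww_conflict x y ->
  [/\ tx x <> tx y, tup x = tup y, is_write x & is_write y].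
Proof.
case/andP => /andP[/eqP dxy /eqP txy] h; split=> //.
  exact: WriteSet_is_write h.
by move: h; rewrite fsetIC; apply: WriteSet_is_write.
Qed.

Lemma rw_conflictP x y : rw_conflict x y ->
  [/\ tx x <> tx y, tup x = tup y, is_read x & is_write y].
Proof.
case/andP => /andP[/eqP dxy /eqP txy] h; split=> //.
  exact: ReadSet_is_read h.
by move: h; rewrite fsetIC; apply: WriteSet_is_write.
Qed.

Lemma wr_conflictP x y : wr_conflict x y ->
  [/\ tx x <> tx y, tup x = tup y, is_write x & is_read y].
Proof. by rewrite wr_rw_conflict => /rw_conflictP[? ? ? ?]; split=> // /esym. Qed.

Lemma conflict_tx x y : conflict x y -> tx x <> tx y.
Proof.
by case/or3P => [/ww_conflictP|/wr_conflictP|/rw_conflictP] [].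
Qed.

Variable s : schedule T.

Lemma slt_irr o : slt s o o = false.
Proof. by rewrite /slt /strict eqxx. Qed.

Lemma slt_le o1 o2 : slt s o1 o2 -> sle s o1 o2.
Proof. by case/andP. Qed.

Lemma slt_le_trans o1 o2 o3 : slt s o1 o2 -> sle s o2 o3 -> slt s o1 o3.
Proof.
case/andP => n12 l12 l23; rewrite /slt /strict (sle_trans l12 l23) andbT.
apply: contra n12 => /eqP e; rewrite -e in l23; apply/eqP.
by apply: (@sle_anti _ _ s); rewrite l12.
Qed.

Lemma sle_lt_trans o1 o2 o3 : sle s o1 o2 -> slt s o2 o3 -> slt s o1 o3.
Proof.
move=> l12 /andP[n23 l23]; rewrite /slt /strict (sle_trans l12 l23) andbT.
apply: contra n23 => /eqP e; rewrite e in l12; apply/eqP.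
by apply: (@sle_anti _ _ s); rewrite l12 l23.
Qed.

Lemma slt_trans o1 o2 o3 : slt s o1 o2 -> slt s o2 o3 -> slt s o1 o3.
Proof. by move=> l12 /slt_le; apply: slt_le_trans. Qed.

Lemma slt_asym o1 o2 : slt s o1 o2 -> slt s o2 o1 -> False.
Proof. by move=> h1 h2; have := slt_trans h1 h2; rewrite slt_irr. Qed.

Lemma slt_leN o1 o2 : slt s o1 o2 -> sle s o2 o1 -> False.
Proof. by move=> h1 h2; have := slt_le_trans h1 h2; rewrite slt_irr. Qed.

Lemma slt_total o1 o2 : o1 <> o2 -> slt s o1 o2 \/ slt s o2 o1.
Proof.
move/eqP => n; rewrite /slt /strict n eq_sym n /=.
by case/orP: (sle_total s o1 o2); [left|right].
Qed.

Lemma slt_commit x : slt s (Act x) (Commit (tx x)).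
Proof. by apply: sle_tx; rewrite /= eqxx. Qed.

Lemma sle_rank x y : tx x = tx y -> rank x <= rank y -> sle s (Act x) (Act y).
Proof.
move=> e; rewrite leq_eqVlt => /orP[/eqP r|r].
  by rewrite (occ_inj e r); case/orP: (sle_total s (Act y) (Act y)).
by apply: slt_le; apply: sle_tx; rewrite /= e eqxx.
Qed.

Lemma vers_op0 x : is_write x -> vers_lt s (Act x) Op0 -> False.
Proof.
move=> w h; have := @vers_irr _ _ s (tup x) Op0 isT; apply/negP; rewrite negbK.
apply: (@vers_trans _ _ s (tup x) Op0 (Act x) Op0) => //.
  by rewrite unfold_in /= w eqxx.
exact: op0_vers.
Qed.

Lemma vfun_installs x : is_read x -> installs (tup x) (vfun s x).
Proof.
move=> r; case: (vfun_cod s r) => [->//|[y [-> wy _ ty]]].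
by rewrite /= wy ty eqxx.
Qed.

Lemma act_installs x t : is_write x -> tup x = t -> installs t (Act x).
Proof. by move=> w <-; rewrite /= w eqxx. Qed.

Lemma depends_conflict b a : depends s b a -> conflict b a.
Proof. by rewrite /conflict => -[[-> _]|[-> _]|[-> _]]; rewrite ?orbT. Qed.

(** Totality of the version order yields a direction. A conflicting write either installs the
    version read, or precedes it (wr in both cases), or follows it (rw). *)
Lemma conflict_depends b a : conflict b a -> depends s b a \/ depends s a b.
Proof.
have rw x y : rw_conflict x y -> depends s x y \/ depends s y x.
  move=> c; have [_ t r w] := rw_conflictP c.
  have [e|n] := eqVneq (Act y) (vfun s x).
    by right; constructor 2; rewrite wr_rw_conflict; split; last left.
  have iy := act_installs w (esym t).
  case/orP: (vers_total s iy (vfun_installs r) n) => h.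
    by right; constructor 2; rewrite wr_rw_conflict; split; last right.
  by left; constructor 3.
case/or3P; last exact: rw.
  move=> c; have [d t wb wa] := ww_conflictP c.
  have n : Act b != Act a by apply/eqP => -[e]; apply: d; rewrite e.
  have := vers_total s (act_installs wb t) (act_installs wa erefl) n.
  case/orP => h; [left|right]; constructor 1 => //.
  by rewrite ww_conflictC.
by rewrite wr_rw_conflict => /rw[]; [right|left].
Qed.

(** A boolean form, so that the graph on transactions is a [rel] for [connect] and [cycle]. *)
Definition dependsb b a : bool :=
  [|| ww_conflict b a && vers_lt s (Act b) (Act a),
      wr_conflict b a &&
        ((Act b == vfun s a) || vers_lt s (Act b) (vfun s a))
    | rw_conflict b a && vers_lt s (vfun s b) (Act a)].

Lemma dependsP b a : reflect (depends s b a) (dependsb b a).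
Proof.
apply: (iffP or3P).
  case=> [/andP[]|/andP[c /orP[/eqP|]]|/andP[]].
  - by constructor 1.
  - by constructor 2; split; last left.
  - by constructor 2; split; last right.
  - by constructor 3.
case=> [[c v]|[c [v|v]]|[c v]].
- by constructor 1; rewrite c.
- by constructor 2; rewrite c v eqxx.
- by constructor 2; rewrite c v orbT.
- by constructor 3; rewrite c.
Qed.

(** This is the serialization graph of [s]. *)
Definition dep_graph : rel (txid T) := fun i j =>
  [exists b, exists a, [&& tx b == i, tx a == j & dependsb b a]].

Lemma dep_graphP i j :
  reflect (exists b a, [/\ tx b = i, tx a = j & depends s b a])
          (dep_graph i j).
Proof.
apply: (iffP existsP) => [[b /existsP[a /and3P[/eqP ? /eqP ? /dependsP ?]]]|].
  by exists b, a.
case=> b [a [<- <- /dependsP d]].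
by exists b; apply/existsP; exists a; rewrite !eqxx.
Qed.

Lemma dep_graph_irr i : dep_graph i i = false.
Proof.
apply/dep_graphP => -[b [a [<- e /depends_conflict /conflict_tx]]].
by rewrite e.
Qed.

(** Versions follow time and a read sees the last write before it, so each clause of [depends]
    reduces to the order in time. *)
Lemma serial_depends b a : single_version_serial s -> conflict b a ->
  depends s b a <-> slt s (Act b) (Act a).
Proof.
move=> [[vers_slt vfun_last] _].
have rw x y : rw_conflict x y ->
    vers_lt s (vfun s x) (Act y) <-> slt s (Act x) (Act y).
  move=> c; have [d t r w] := rw_conflictP c.
  have n : Act x <> Act y by move=> [e]; apply: d; rewrite e.
  split=> h.
    (* A write [y] before [x] would lie between the version read and [x]. *)
    case: (slt_total n) => // yx; case: (vfun_last _ r).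
    exists y; split=> //; case: (vfun_cod s r) h => [->|[z [-> wz _ tz]]].
      by rewrite /slt /strict op0_first.
    by move=> vzy; apply/vers_slt => //; rewrite tz.
  case: (vfun_cod s r) (vfun_lt s r) => [->|[z [-> wz _ tz]]] vx.
    exact: op0_vers.
  apply/vers_slt => //; first by rewrite tz.
  exact: slt_trans h.
have wr x y : wr_conflict x y ->
    (Act x = vfun s y \/ vers_lt s (Act x) (vfun s y)) <->
    slt s (Act x) (Act y).
  move=> c; have [d t w r] := wr_conflictP c; split=> h.
    have vy := vfun_lt s r; case: h => [->|] //.
    case: (vfun_cod s r) vy => [->|[z [-> wz _ tz]]] vy.
      by move/(vers_op0 w).
    by move/vers_slt => h; apply: slt_trans vy; apply: h => //; rewrite tz.
  have [e|/eqP n] := eqVneq (Act x) (vfun s y); [by left|right].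
  case: (slt_total n) => l.
    case: (vfun_cod s r) l => [->|[z [-> wz _ tz]]] l.
      by case: (slt_leN l (op0_first s _)).
    by apply/vers_slt => //; rewrite tz.
  by case: (vfun_last _ r); exists x.
move=> c; split.
  case=> [[c' v]|[c' v]|[c' v]]; [|exact/wr|exact/rw].
  by have [d t wb wa] := ww_conflictP c'; apply/vers_slt.
move=> l; case/or3P: c => c.
- by constructor 1; have [d t wb wa] := ww_conflictP c; split=> //; apply/vers_slt.
- by constructor 2; split=> //; apply/wr.
- by constructor 3; split=> //; apply/rw.
Qed.

(** If [tx y] committed first, [y] would lie between [x] and the commit of [tx x], so seriality
    would put it in [tx x]. *)
Lemma serial_commit x y : single_version_serial s -> tx x <> tx y ->
  slt s (Act x) (Act y) -> slt s (Commit (tx x)) (Commit (tx y)).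
Proof.
move=> [_ ser] d l; have n : @Commit _ T (tx x) <> Commit (tx y) by case.
case: (slt_total n) => // yx; case: d; apply/eqP; rewrite eq_sym.
exact: (ser (tx x) (Act x) (Act y) (Commit (tx x)) l
            (slt_trans (slt_commit y) yx) (eqxx _) (eqxx _)).
Qed.

End Conflicts.

(** Every edge goes forward in the commit order of the equivalent serial schedule, so no cycle can
    close. *)
Lemma serializable_acyclic (S : schema) (T : seq (transaction S))
    (s : schedule T) (i j : txid T) :
  conflict_serializable s -> dep_graph s i j -> connect (dep_graph s) j i ->
  False.
Proof.
move=> [s' [ser eqv]].
have edge u v : dep_graph s u v -> slt s' (Commit u) (Commit v).
  case/dep_graphP => b [a [<- <- d]]; have c := depends_conflict d.
  apply: serial_commit => //; first exact: conflict_tx.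
  by apply/serial_depends => //; apply/eqv => //; rewrite conflictC.
move=> /edge ij /connectP[p ep lp].
suff: sle s' (Commit j) (Commit i) by apply: slt_leN ij.
rewrite {ij}lp; elim: p j ep => [|k p IH] j /=.
  by case/orP: (sle_total s' (Commit j) (Commit j)).
by case/andP => /edge/slt_le jk /IH; apply: sle_trans jk.
Qed.

(** * Schedules given by numeric keys *)

Section ScheduleFromKeys.

Variables (S : schema) (T : seq (transaction S)).
(** [key] is the place in time, [vkey] the place in the version order, and [vis y x] says that the
    read [x] may see the write [y]. *)
Variables (key vkey : operation T -> nat) (vis : rel (occ T)).
Hypotheses (key_inj : injective key) (key0 : forall o, key Op0 <= key o).
Hypothesis key_tx : forall a b, tx_lt a b -> key a < key b.
Hypotheses (vkey_inj : injective vkey) (vkey0 : forall o, vkey Op0 <= vkey o).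
Hypothesis vis_key : forall y x, vis y x -> key (Act y) < key (Act x).

Definition readable (x : occ T) : pred (operation T) := fun o =>
  match o with
  | Op0 => true
  | Act y => [&& is_write y, tup y == tup x & vis y x]
  | Commit _ => false
  end.

Definition last_readable (x : occ T) : operation T :=
  [arg max_(o > Op0 | readable x o) vkey o].

Lemma last_readableP x : readable x (last_readable x) /\
  forall o, readable x o -> vkey o <= vkey (last_readable x).
Proof. by rewrite /last_readable; case: arg_maxnP. Qed.

Lemma last_readable_cod x : last_readable x = Op0 \/
  exists y, [/\ last_readable x = Act y, is_write y, tup y = tup x & vis y x].
Proof.
case: (last_readableP x) => + _; case: (last_readable x) => [|y|//]; first by left.
by case/and3P => w /eqP t v; right; exists y.
Qed.

(** Injective keys give strict total orders, and visible writes are earlier in time, so reading the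
    newest visible version is a legal version function. *)
Lemma schedule_from_keys : exists s : schedule T,
  [/\ forall a b, slt s a b = (key a < key b),
      forall a b, vers_lt s a b = (vkey a < vkey b),
      forall x, vfun s x = Op0 \/
        exists y, [/\ vfun s x = Act y, is_write y, tup y = tup x & vis y x]
    & forall x y, is_write y -> tup y = tup x -> vis y x ->
        vkey (Act y) <= vkey (vfun s x)].
Proof.
pose le a b := key a <= key b.
have strictE a b : strict le a b = (key a < key b).
  by rewrite /strict /le ltn_neqAle (inj_eq key_inj).
have anti : antisymmetric le.
  by move=> a b; rewrite /le -eqn_leq => /eqP /key_inj.
have trans : transitive le by move=> b a c; apply: leq_trans.
have total : total le by move=> a b; apply: leq_total.
pose vlt a b := vkey a < vkey b.
have virr (t : dbtuple S) : {in @installs S T t, forall a, ~~ vlt a a}.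
  by move=> a _; rewrite /vlt ltnn.
have vtrans (t : dbtuple S) : {in @installs S T t & installs t & installs t,
    forall a b c, vlt a b -> vlt b c -> vlt a c}.
  by move=> a b c _ _ _; apply: ltn_trans.
have vtotal (t : dbtuple S) : {in @installs S T t & installs t,
    forall a b, a != b -> vlt a b || vlt b a}.
  by move=> a b _ _; rewrite /vlt -neq_ltn (inj_eq vkey_inj).
have v0 (x : occ T) : is_write x -> vlt Op0 (Act x).
  by rewrite /vlt ltn_neqAle vkey0 (inj_eq vkey_inj).
have ktx a b : tx_lt a b -> strict le a b by rewrite strictE; apply: key_tx.
have vcod x : is_read x -> last_readable x = Op0 \/
    exists y, [/\ last_readable x = Act y, is_write y, y <> x & tup y = tup x].
  move=> _; case: (last_readable_cod x) => [|[y [-> w t /vis_key v]]]; first by left.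
  by right; exists y; split=> // e; rewrite e ltnn in v.
have vlast x : is_read x -> strict le (last_readable x) (Act x).
  move=> _; rewrite strictE; case: (last_readable_cod x) => [->|[y [-> _ _]]].
    by rewrite ltn_neqAle key0 (inj_eq key_inj).
  exact: vis_key.
exists (Schedule anti trans total virr vtrans vtotal key0 v0 ktx vcod vlast).
split=> //=; first exact: last_readable_cod.
move=> x y w t v; case: (last_readableP x) => _; apply.
by rewrite /= w t eqxx v.
Qed.

End ScheduleFromKeys.

(** * Transactions run as blocks, with a prefix moved to the front *)

Section Blocks.

Variables (S : schema) (T : seq (transaction S)) (p : txid T -> nat).
Hypothesis p_inj : injective p.

Definition max_rank : nat :=
  \max_(i : txid T) size (actions (tnth (in_tuple T) i)).

Lemma rank_lt (x : occ T) : rank x < max_rank.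
Proof.
apply: leq_trans (ltn_ord (tagged x)) _.
exact: (@leq_bigmax _ (fun i => size (actions (tnth (in_tuple T) i)))).
Qed.

Section Prefix.

Variable pre : pred (occ T).
Hypothesis pre_tx : forall x y, pre x -> pre y -> tx x = tx y.
Hypothesis pre_down :
  forall x y, tx x = tx y -> rank x < rank y -> pre y -> pre x.

(** Block 0 is reserved for [Op0] and block 1 for the prefix [pre], hence the shift by two. *)
Definition block (o : operation T) : nat :=
  match o with
  | Op0 => 0
  | Act x => if pre x then 1 else (p (tx x)).+2
  | Commit i => (p i).+2
  end.

Definition offset (o : operation T) : nat :=
  match o with
  | Op0 => 0
  | Act x => rank x
  | Commit _ => max_rank
  end.

(** The lexicographic order of [block] and [offset], as a two-digit number in base [max_rank.+1]; a
    commit has the digit [max_rank], above every rank. *)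
Definition block_key (o : operation T) : nat :=
  block o * max_rank.+1 + offset o.

Lemma offset_lt o : offset o < max_rank.+1.
Proof. by case: o => [|x|i] //=; apply: ltnW; rewrite ltnS; apply: rank_lt. Qed.

Lemma block_divn o : block_key o %/ max_rank.+1 = block o.
Proof. by rewrite divnMDl // divn_small ?addn0 // offset_lt. Qed.

Lemma block_modn o : block_key o %% max_rank.+1 = offset o.
Proof. by rewrite modnMDl modn_small // offset_lt. Qed.

Lemma block_le a b : block_key a <= block_key b -> block a <= block b.
Proof. by move/(@leq_div2r max_rank.+1); rewrite !block_divn. Qed.

Lemma block_lt a b : block a < block b -> block_key a < block_key b.
Proof. by move=> h; rewrite ltnNge; apply/negP => /block_le; rewrite leqNgt h. Qed.

Lemma block_key_same a b : block a = block b ->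
  (block_key a < block_key b) = (offset a < offset b).
Proof. by rewrite /block_key => ->; rewrite ltn_add2l. Qed.

Lemma block_tx x y : block (Act x) = block (Act y) -> tx x = tx y.
Proof.
move=> /=; case: ifP => px; case: ifP => py //; first by move=> _; apply: pre_tx.
by case=> /p_inj.
Qed.

Lemma block_key_inj : injective block_key.
Proof.
move=> a b e; have := congr1 (divn^~ max_rank.+1) e.
have := congr1 (modn^~ max_rank.+1) e; rewrite /= !block_divn !block_modn {e}.
case: a b => [|x|i] [|y|j] //.
- by rewrite /=; case: ifP.
- by rewrite /=; case: ifP.
- by move=> o /block_tx t; congr Act; apply: occ_inj.
- by move=> /= o; have := rank_lt x; rewrite o ltnn.
- by move=> /= o; have := rank_lt y; rewrite -o ltnn.
- by move=> _ [/p_inj->].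
Qed.

Lemma block_key0 o : block_key Op0 <= block_key o. Proof. by []. Qed.

Lemma block_key_tx a b : tx_lt a b -> block_key a < block_key b.
Proof.
case: a b => [|x|i] [|y|j] //=; last first.
  move/eqP=> <-; have [px|px] := boolP (pre x).
    by apply: block_lt; rewrite /= px.
  by rewrite block_key_same /= ?(negbTE px) //; apply: rank_lt.
case/andP => /eqP t r; have [py|py] := boolP (pre y).
  have px := pre_down t r py.
  by rewrite block_key_same //= px py.
have [px|px] := boolP (pre x).
  by apply: block_lt; rewrite /= px (negbTE py).
by rewrite block_key_same //= (negbTE px) (negbTE py) t.
Qed.

Lemma block_key_commit i j :
  (block_key (Commit i) < block_key (Commit j)) = (p i < p j).
Proof.
apply/idP/idP => [|h]; last exact: block_lt.
rewrite ltnNge => h; rewrite ltnNge; apply: contra h => h.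
by rewrite /block_key /= leq_add2r leq_mul2r; lia.
Qed.

End Prefix.

Lemma serial_key_lt x y : tx x <> tx y ->
  (block_key pred0 (Act x) < block_key pred0 (Act y)) = (p (tx x) < p (tx y)).
Proof.
move=> d; apply/idP/idP => [/ltnW/block_le /=|h]; last exact: block_lt.
by rewrite !ltnS leq_eqVlt => /orP[/eqP/p_inj|].
Qed.

(** With an empty prefix, one key serves for both time and versions, and every earlier write is
    visible. *)
Lemma serial_schedule : exists s : schedule T, single_version_serial s /\
  forall x y, tx x <> tx y -> slt s (Act x) (Act y) = (p (tx x) < p (tx y)).
Proof.
pose k := block_key pred0; pose vis := [rel y x | k (Act y) < k (Act x)].
have pt (x y : occ T) : pred0 x -> pred0 y -> tx x = tx y by [].
have pd (x y : occ T) : tx x = tx y -> rank x < rank y -> pred0 y -> pred0 x by [].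
have kinj : injective k := block_key_inj pt.
have ktx : forall a b, tx_lt a b -> k a < k b := block_key_tx pd.
have visk y x : vis y x -> k (Act y) < k (Act x) by [].
have [s [slts vlts vfc vfm]] := schedule_from_keys kinj (@block_key0 _) ktx kinj
  (@block_key0 _) visk.
exists s; split; last by move=> x y d; rewrite slts; apply: serial_key_lt.
split; first split.
- by move=> x y _ _ _; rewrite slts vlts.
- move=> x r [z [wz tz]]; rewrite !slts => vz zx.
  by have := vfm x z wz tz zx; rewrite leqNgt vz.
move=> i a b c; rewrite !slts => /ltnW/block_le ab /ltnW/block_le bc ia ic.
(* Transaction [i] fills exactly one block, and [block] is monotone in time, so [b] is squeezed into
   it. *)
have bi (o : operation T) : in_tx i o = (block pred0 o == (p i).+2).
  by case: o => //= [x|j]; rewrite !eqSS (inj_eq p_inj).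
move: ia ic; rewrite !bi => /eqP ia /eqP ic.
by rewrite eqn_leq -{1}ic bc -ia ab.
Qed.

End Blocks.

(** A serial schedule in a topological order of the graph has the same dependencies. *)
Lemma acyclic_serializable (S : schema) (T : seq (transaction S))
    (s : schedule T) :
  (forall i j, dep_graph s i j -> ~~ connect (dep_graph s) j i) ->
  conflict_serializable s.
Proof.
move=> acyc.
(* The number of ancestors grows strictly along edges by acyclicity; the index then breaks ties in
   [p]. *)
pose f i := #|[pred j | connect (dep_graph s) j i]|.
pose p (i : txid T) := f i * size T + i.
have p_inj : injective p.
  move=> i j /(congr1 (modn^~ (size T))); rewrite /p !modnMDl.
  by rewrite !modn_small // => /val_inj.
have p_mono i j : dep_graph s i j -> p i < p j.
  move=> ij; suff h : f i < f j.
    have : (f i).+1 * size T <= f j * size T by rewrite leq_mul2r h orbT.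
    by have := ltn_ord i; rewrite /p; lia.
  apply: proper_card; apply/properP; split.
    apply/subsetP => k; rewrite !inE => ki.
    exact: connect_trans ki (connect1 ij).
  by exists j; rewrite !inE ?connect0 ?acyc.
have [s' [ser slts]] := serial_schedule p_inj.
exists s'; split=> // a b ab.
have ba : conflict b a by rewrite conflictC.
split=> [d|].
  apply/serial_depends => //; rewrite slts; last exact: conflict_tx.
  by apply: p_mono; apply/dep_graphP; exists b, a.
move/serial_depends => /(_ ser ba); rewrite slts; last exact: conflict_tx.
(* A dependency in the opposite direction would make [p] decrease along an edge. *)
move=> h; case: (conflict_depends s ba) => // d.
suff : p (tx a) < p (tx b) by lia.
by apply: p_mono; apply/dep_graphP; exists a, b.
Qed.

(** * From a cycle of dependencies to a witness *)

Section SplitWitness.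

Variables (S : schema) (T : seq (transaction S)).
Implicit Types (x y a b : occ T) (i j : txid T).

(** The nodes of the prefix-conflict-free graph for the prefix of [tx b1] ending in [b1]. *)
Definition pcf_node b1 i : bool :=
  (i != tx b1) && [forall x, forall y,
    [&& tx x == i, tx y == tx b1 & rank y <= rank b1] ==> ~~ ww_conflict x y].

Lemma pcf_nodeP b1 i :
  reflect (i <> tx b1 /\ forall x y, tx x = i -> tx y = tx b1 ->
             rank y <= rank b1 -> ~~ ww_conflict x y) (pcf_node b1 i).
Proof.
apply: (iffP andP) => [[/eqP d /forallP h]|[/eqP d h]]; split=> //.
  move=> x y xk yk r; have /forallP/(_ y)/implyP := h x; apply.
  by rewrite xk yk !eqxx.
apply/forallP=> x; apply/forallP=> y; apply/implyP => /and3P[/eqP tx /eqP ty].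
exact: h.
Qed.

Definition pcf_edge b1 : rel (txid T) := fun i j =>
  [&& pcf_node b1 i, pcf_node b1 j &
      [exists x, exists y, [&& tx x == i, tx y == j & conflict x y]]].

(** The data on which Algorithm 1 returns False, with [tx b1], [tx a2], [tx bm] as T1, T2, Tm. *)
Definition split_witness : Prop := exists b1 a1 a2 bm : occ T,
  [/\ tx a1 = tx b1, pcf_node b1 (tx a2), pcf_node b1 (tx bm),
      connect (pcf_edge b1) (tx a2) (tx bm) &
      [&& conflict a1 bm, rw_conflict b1 a2 &
          (rank b1 < rank a1) || rw_conflict bm a1]].

(** * Dependencies in schedules allowed under RC *)

Section ReadCommitted.

Variable s : schedule T.
Hypothesis rc : allowed_under_RC s.

Lemma ww_depends_commit b a : ww_conflict b a -> vers_lt s (Act b) (Act a) ->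
  slt s (Commit (tx b)) (Commit (tx a)).
Proof. by move=> c v; have [d t wb wa] := ww_conflictP c; apply/rc.1.1. Qed.

(** The version read is committed before [a], and by the commit order older versions from other
    transactions are committed even earlier. *)
Lemma wr_depends_commit b a : wr_conflict b a ->
  Act b = vfun s a \/ vers_lt s (Act b) (vfun s a) ->
  slt s (Commit (tx b)) (Act a).
Proof.
move=> c v; have [d t wb ra] := wr_conflictP c.
case: (rc.1.2 a ra).1 v => [->|[z [vz lz]]] [] //; first by move/(vers_op0 wb).
  by rewrite vz => -[->].
rewrite vz => v; case: (vfun_cod s ra); rewrite vz // => -[_ [[<-] wz _ tz]].
have [e|/eqP n] := eqVneq (tx b) (tx z); first by rewrite e.
by apply: slt_trans lz; apply/rc.1.1 => //; rewrite tz.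
Qed.

(** Had [tx a] committed before the read [b], then [b] could not have read a version older than
    [a]. *)
Lemma rw_depends_commit b a : rw_conflict b a ->
  vers_lt s (vfun s b) (Act a) -> slt s (Act b) (Commit (tx a)).
Proof.
move=> c v; have [d t rb wa] := rw_conflictP c.
have n : Act b <> Commit (tx a) by [].
case: (slt_total s n) => // l; case: (rc.1.2 b rb).2; exists a; split=> //.
Qed.

(* Reversing the commit order takes an rw-antidependency: this is how the two
   consecutive transactions T1, T2 of the witness are found. *)
Lemma depends_anti b a : depends s b a ->
  slt s (Commit (tx a)) (Commit (tx b)) ->
  rw_conflict b a /\ slt s (Act b) (Commit (tx a)).
Proof.
case=> [[c v]|[c v]|[c v]] l.
- by case: (slt_asym l (ww_depends_commit c v)).
- have h := wr_depends_commit c v.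
  by case: (slt_asym (slt_trans h (slt_commit s a)) l).
- by split=> //; apply: rw_depends_commit.
Qed.

(** Otherwise [a] would be a dirty write over [b]. *)
Lemma ww_order b a : ww_conflict b a -> slt s (Act b) (Act a) ->
  slt s (Commit (tx b)) (Act a).
Proof.
move=> c l; have n : Act a <> Commit (tx b) by [].
by case: (slt_total s n) => // h; case: rc.2; exists b, a.
Qed.

Lemma minimal_cycle i j : dep_graph s i j -> connect (dep_graph s) j i ->
  exists c : seq (txid T), [/\ c != [::], cycle (dep_graph s) c &
    forall c', c' != [::] -> cycle (dep_graph s) c' -> size c <= size c'].
Proof.
move=> ij /connectP[q eq lq].
(* Tuples make the existence of a cycle of length [n] decidable, as [ex_minnP] requires. *)
pose P n := [exists c : n.-tuple (txid T), (n > 0) && cycle (dep_graph s) c].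
have PP (c : seq (txid T)) :
    c != [::] -> cycle (dep_graph s) c -> P (size c).
  by move=> c0 cc; apply/existsP; exists (in_tuple c); case: c c0 cc.
have exP : exists n, P n.
  by exists (size (j :: q)); apply: PP => //=; rewrite rcons_path eq -lq.
case: (ex_minnP exP) => n /existsP[c /andP[n0 cc]] min_n.
exists c; split=> // [|c' c0 cc']; first by rewrite -size_eq0 size_tuple -lt0n.
by rewrite size_tuple; apply/min_n/PP.
Qed.

Lemma cyclic_split_witness i j :
  dep_graph s i j -> connect (dep_graph s) j i -> split_witness.
Proof.
move=> ij ji; have [c [c0 cc min_c]] := minimal_cycle ij ji.
(* T2 is the transaction of the cycle that commits first. *)
have [i2 i2c first2] : exists2 i2, i2 \in c &
    forall k, k \in c -> sle s (Commit i2) (Commit k).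
  elim: c c0 {cc min_c} => // k c IH _; case: c IH => [|k' c] IH.
    exists k; first exact: mem_head.
    by move=> l; rewrite inE => /eqP->; case/orP: (sle_total s (Commit k) (Commit k)).
  have [//|m mc mmin] := IH.
  case/orP: (sle_total s (Commit k) (Commit m)) => km.
    exists k; first exact: mem_head.
    move=> l; rewrite inE => /orP[/eqP->|/mmin]; last exact: sle_trans.
    by case/orP: (sle_total s (Commit k) (Commit k)).
  exists m; first by rewrite inE mc orbT.
  by move=> l; rewrite inE => /orP[/eqP->//|/mmin].
(* Rotate the cycle to start at [i2]; its last element [i1] is then T1. A cycle of length one is
   excluded by irreflexivity. *)
have [n q rot_c] := rot_to i2c.
have cq : cycle (dep_graph s) (i2 :: q) by rewrite -rot_c rot_cycle.
have min_q c' : c' != [::] -> cycle (dep_graph s) c' -> (size q).+1 <= size c'.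
  by move=> h1 h2; have := min_c c' h1 h2; rewrite -(size_rot n c) rot_c.
have {}first2 k : k \in i2 :: q -> sle s (Commit i2) (Commit k).
  by rewrite -rot_c mem_rot; apply: first2.
move=> {n c c0 cc min_c i2c rot_c}; move: cq min_q first2; case/lastP: q => [|q i1].
  by rewrite /= dep_graph_irr.
rewrite /= !rcons_path last_rcons size_rcons.
case/andP => /andP[pq gm1] g12 min_q first2.
have n12 : i1 <> i2 by move=> e; rewrite e dep_graph_irr in g12.
have first1 : slt s (Commit i2) (Commit i1).
  have /first2 : i1 \in i2 :: rcons q i1 by rewrite inE mem_rcons mem_head orbT.
  by case: (@slt_total _ _ s (Commit i1) (Commit i2)) => [[]//|l h|//];
    case: (slt_leN l h).
have {}first2 k : k \in i2 :: q -> sle s (Commit i2) (Commit k).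
  by move=> h; apply: first2; rewrite -rcons_cons mem_rcons inE h orbT.
(* If [k] lay beyond [i2], the stretch of the cycle from [i2] up to [k] could be skipped, against
   minimality. *)
have chordless k : k \in i2 :: q -> k = i1 \/ dep_graph s i1 k -> k = i2.
  rewrite inE => /orP[/eqP //|kq] h.
  case: {kq}q / (splitPr kq) pq gm1 min_q {first2} => A B.
  rewrite cat_path last_cat size_cat /= => /and3P[_ _ pB] gm1 min_q.
  case: h => [e|g1k].
    have gk : dep_graph s (last k B) k by rewrite {2}e.
    have := min_q (k :: B) isT; rewrite /= rcons_path pB gk.
    by move=> /(_ isT); lia.
  have := min_q (i1 :: k :: B) isT; rewrite /= rcons_path g1k pB gm1 /=.
  by move=> /(_ isT); lia.
have [b1 [a2 [tb1 ta2 d12]]] := dep_graphP _ _ _ g12.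
have [bm [a1 [tbm ta1 dm1]]] := dep_graphP _ _ _ gm1.
have [rw12 b1_C2] : rw_conflict b1 a2 /\ slt s (Act b1) (Commit i2).
  by rewrite -ta2; apply: depends_anti => //; rewrite ta2 tb1.
have node k : k \in i2 :: q -> pcf_node b1 k.
  move=> kq; apply/pcf_nodeP; rewrite tb1; split=> [e|x y xk yk r].
    by apply: n12; rewrite -e; apply: chordless => //; left.
  apply/negP => ww; have [d _ wx wy] := ww_conflictP ww.
  have yb1 : sle s (Act y) (Act b1) by apply: sle_rank; rewrite ?yk.
  have n : Act x <> Act y by move=> [e]; apply: d; rewrite e.
  (* If [x] comes first, [k] commits before [y], which is at or before [b1], hence before the commit
     of [i2]. *)
  case: (slt_total s n) => l.
    have := sle_lt_trans (sle_trans (slt_le (ww_order ww l)) yb1) b1_C2.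
    by rewrite xk => /slt_leN; apply; apply: first2.
  (* If [y] comes first, T1 commits before [k], so [i1] has an edge to [k]. Then [k] is [i2], which
     commits before [i1]. *)
  rewrite ww_conflictC in ww; have := slt_trans (ww_order ww l) (slt_commit s x).
  move=> C1k; have k2 : k = i2.
    apply: chordless => //; right; apply/dep_graphP; exists y, x; split=> //.
    constructor 1; split=> //; apply/rc.1.1 => //; last exact: nesym.
    by case/ww_conflictP: ww.
  by rewrite yk xk k2 in C1k; apply: slt_asym first1.
have nodem : last i2 q \in i2 :: q by rewrite mem_last.
exists b1, a1, a2, bm; rewrite ta2 tbm tb1 rw12; split=> //.
- by apply: node; rewrite mem_head.
- exact: node.
- apply/connectP; exists q => //.
  elim: q i2 pq node {gm1 chordless nodem tbm min_q first2 g12 n12 first1 ta2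
    b1_C2} => //= k q IH j'.
  case/andP => gjk pk nd; rewrite {1}/pcf_edge !nd ?inE ?eqxx ?orbT //=.
  apply/andP; split; last by apply: IH => // l lq; apply: nd; rewrite inE lq orbT.
  have [b [a [tb ta d]]] := dep_graphP _ _ _ gjk.
  apply/existsP; exists b; apply/existsP; exists a.
  by rewrite tb ta !eqxx (depends_conflict d).
rewrite conflictC (depends_conflict dm1) /=.
(* With [a1] in the prefix, the last edge must be an rw-conflict: ww is excluded for a node, and wr
   would make Tm commit before [b1], thus before T2. *)
case: ltnP => //= a1_b1; have a1b1 : sle s (Act a1) (Act b1).
  by apply: sle_rank => //; rewrite ta1.
case: dm1 => [[ww _]|[wr v]|[]] //.
  have /pcf_nodeP[_ /(_ bm a1 tbm)] := node _ nodem.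
  by rewrite ta1 tb1 ww => /(_ erefl a1_b1).
have := sle_lt_trans (sle_trans (slt_le (wr_depends_commit wr v)) a1b1) b1_C2.
by rewrite tbm => /slt_leN; case; apply: first2.
Qed.

End ReadCommitted.

End SplitWitness.

(** * From a witness to a split schedule *)

Section SplitSchedule.

Variables (S : schema) (T : seq (transaction S)) (b1 : occ T).
Variable p : txid T -> nat.
Hypothesis p_inj : injective p.
Hypothesis p_node : forall i, p i < p (tx b1) -> pcf_node b1 i.

Definition in_prefix : pred (occ T) :=
  [pred x | (tx x == tx b1) && (rank x <= rank b1)].

(** The prefix of T1 runs first, then the transactions in the order [p], the rest of T1 at its own
    place. Only the prefix is interleaved with others, and by [p_node] the transactions run before
    T1 resumes have no ww-conflict with it. *)
Lemma split_schedule : exists s : schedule T,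
  [/\ allowed_under_RC s,
      forall a, rw_conflict b1 a -> depends s b1 a &
      forall b a, conflict b a -> p (tx b) < p (tx a) ->
        ~~ in_prefix a || rw_conflict b a -> depends s b a].
Proof.
(* Versions are ordered as if T1 ran entirely where its suffix runs: this is the
   commit order. *)
pose k := block_key p in_prefix; pose vk := block_key p pred0.
pose vis : rel (occ T) := [rel y x | k (Commit (tx y)) < k (Act x)].
have pt x y : in_prefix x -> in_prefix y -> tx x = tx y.
  by move=> /andP[/eqP-> _] /andP[/eqP-> _].
have pd x y : tx x = tx y -> rank x < rank y -> in_prefix y -> in_prefix x.
  by rewrite /in_prefix /= => -> r /andP[-> h]; apply: leq_trans h; apply: ltnW.
have pt0 (x y : occ T) : pred0 x -> pred0 y -> tx x = tx y by [].
have kinj : injective k := block_key_inj p_inj pt.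
have vkinj : injective vk := block_key_inj p_inj pt0.
have ktx : forall a b, tx_lt a b -> k a < k b := block_key_tx p pd.
have visk y x : vis y x -> k (Act y) < k (Act x).
  by apply: ltn_trans; apply: ktx; rewrite /= eqxx.
have [s [slts vlts vfc vfm]] := schedule_from_keys kinj (@block_key0 _ _ _ _) ktx
  vkinj (@block_key0 _ _ _ _) visk.
have vers x y : tx x <> tx y -> vers_lt s (Act x) (Act y) = (p (tx x) < p (tx y)).
  by move=> d; rewrite vlts; apply: serial_key_lt.
(* Reads in the prefix precede all commits and so see only [Op0]; by [visp] and [pvis], the other
   reads see exactly the transactions placed before their own. *)
have visp y x : vis y x -> ~~ in_prefix x /\ p (tx y) < p (tx x).
  move=> h; have := block_le (ltnW h); move: (h); rewrite /=.
  case: ifP => // px _; rewrite !ltnS leq_eqVlt => /orP[/eqP/p_inj e|//].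
  have := ltn_trans h (ktx (Act x) (Commit (tx x)) (eqxx _)).
  by rewrite e ltnn.
have pvis y x : ~~ in_prefix x -> p (tx y) < p (tx x) -> vis y x.
  by move=> /negbTE px h; apply: block_lt; rewrite /= -/(in_prefix x) px.
have rw b a : rw_conflict b a -> p (tx b) <= p (tx a) \/ in_prefix b -> depends s b a.
  move=> c h; have [d t rb wa] := rw_conflictP c; constructor 3; split=> //.
  case: (vfc b) => [->|[z [-> wz tz /visp[nb zb]]]]; first exact: op0_vers.
  case: h => [ba|]; last by rewrite (negbTE nb).
  rewrite vers; first exact: leq_trans ba.
  by move=> e; rewrite e in zb; lia.
exists s; split; first split; first split.
- by move=> b a wb wa t d; rewrite vers // slts block_key_commit.
- move=> a ra; split.
    case: (vfc a) => [->|[y [-> _ _ v]]]; first by left.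
    by right; exists y; split=> //; rewrite slts.
  case=> c [wc tc]; rewrite slts vlts => ca.
  by rewrite ltnNge (vfm a c wc tc ca).
- case=> b [a [ww]]; rewrite !slts => ba aC.
  have [d t wb wa] := ww_conflictP ww.
  have := block_le (ltnW ba); have := block_le (ltnW aC); rewrite /=.
  case: ifP => pa; case: ifP => pb //.
  + by case: d; apply: pt.
  (* Here [b] is in the prefix and [a] runs before T1 resumes, so [tx a] is a node. *)
  + rewrite !ltnS leq_eqVlt => /orP[/eqP/p_inj e|ab _]; first by case: d.
    case/andP: pb => /eqP tb rb; rewrite tb in ab.
    have /pcf_nodeP[_ /(_ a b erefl tb rb)] := p_node ab.
    by rewrite ww_conflictC ww.
  + rewrite !ltnS => h1 h2; case: d; apply: p_inj; lia.
- by move=> a c; apply: rw => //; right; rewrite /in_prefix /= eqxx leqnn.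
move=> b a c ba; case/orP => [pa|c']; last by apply: rw => //; left; apply: ltnW.
case/or3P: c => c.
- by have [d t wb wa] := ww_conflictP c; constructor 1; rewrite vers.
- have [d t wb ra] := wr_conflictP c; constructor 2; split=> //.
  have := vfm a b wb t (pvis _ _ pa ba); rewrite leq_eqVlt => /orP[/eqP/vkinj|].
    by left.
  by right; rewrite vlts.
- by apply: rw => //; left; apply: ltnW.
Qed.

End SplitSchedule.

Lemma split_witness_not_serializable (S : schema) (T : seq (transaction S)) :
  split_witness T ->
  exists s : schedule T, allowed_under_RC s /\ ~ conflict_serializable s.
Proof.
case=> b1 [a1 [a2 [bm [ta1 n2 nm /connectP[q0 pq0 lq0] /and3P[c1m rw12 side]]]]].
(* A simple path gives each transaction on it a single place in the schedule. *)
case/shortenP: pq0 lq0 => q pq uq _ lq {q0}.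
set i1 := tx b1; set i2 := tx a2 in n2 pq uq lq; pose r := rcons (i2 :: q) i1.
have node i : i \in i2 :: q -> pcf_node b1 i.
  rewrite inE => /orP[/eqP->//|]; elim: q i2 pq {r uq lq n2} => //= j q IH k.
  by case/andP => /and3P[_ nj _] pq; rewrite inE => /orP[/eqP->//|]; apply: IH pq.
have n1 : i1 \notin i2 :: q by apply/negP => /node/pcf_nodeP[].
have ur : uniq r by rewrite rcons_uniq n1.
(* The order is T2, ..., Tm, T1, then all remaining transactions by index. *)
pose p (i : txid T) := if i \in r then index i r else size r + i.
have p_inj : injective p.
  move=> i j; rewrite /p; case: ifP => ir; case: ifP => jr.
  - by move=> e; rewrite -(nth_index i1 ir) e nth_index.
  - by move=> e; move: ir; rewrite -index_mem e ltnNge leq_addr.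
  - by move=> e; move: jr; rewrite -index_mem -e ltnNge leq_addr.
  - by move/addnI => /val_inj.
have p_nth n : n <= size q -> p (nth i1 r n) = n.
  move=> h; have hr : n < size r by rewrite size_rcons ltnS leqW.
  by rewrite /p mem_nth // index_uniq.
have p1 : p i1 = (size q).+1.
  by rewrite /p mem_rcons mem_head /r -cats1 index_cat (negbTE n1) /= eqxx addn0.
have p_node i : p i < p i1 -> pcf_node b1 i.
  rewrite p1 /p; case: ifP => [ir h|_]; last first.
    by rewrite size_rcons ltnNge /= !addSn leqW ?leq_addr.
  apply: node; move: ir; rewrite mem_rcons inE => /orP[/eqP e|//].
  by move: h; have := p1; rewrite /p e mem_rcons mem_head => ->; rewrite ltnn.
have [s [rc dep1 dep]] := split_schedule p_inj p_node.
exists s; split=> // ser.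
have nthq n : n <= size q -> nth i1 r n = nth i1 (i2 :: q) n.
  by move=> h; rewrite /r nth_rcons /= ltnS h.
have pathq : path (dep_graph s) i2 q.
  apply/(pathP i1) => n h; have /(pathP i1)/(_ n h) := pq.
  case/and3P => nn ns /existsP[x /existsP[y /and3P[/eqP ex /eqP ey c]]].
  apply/dep_graphP; exists x, y; split=> //; apply: dep => //.
    have -> : p (tx x) = n by rewrite ex -nthq ?p_nth // ltnW.
    suff -> : p (tx y) = n.+1 by [].
    by rewrite ey; have := p_nth n.+1 h; rewrite nthq.
  (* The target is not T1, so [y] lies outside the prefix. *)
  case/pcf_nodeP: ns; rewrite -ey => d _; by rewrite /in_prefix /= (introF eqP d).
have pm : p (tx bm) = size q.
  have := p_nth (size q) (leqnn _); rewrite nthq // => e.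
  by rewrite lq (last_nth i1).
apply: (@serializable_acyclic _ _ s i1 i2 ser).
  by apply/dep_graphP; exists b1, a2; split=> //; apply: dep1.
apply: (@connect_trans _ _ (tx bm)); first by apply/connectP; exists q.
apply: connect1; apply/dep_graphP; exists bm, a1; split=> //.
apply: dep; first by rewrite conflictC.
  by rewrite pm ta1 p1.
(* The last test of the algorithm is what makes the conflict of [bm] and [a1] a dependency of T1 on
   Tm. *)
by case/orP: side => [h|->]; rewrite ?orbT // /in_prefix /= ta1 eqxx -ltnNge h.
Qed.

(** * Result of the algorithm *)

Lemma bind_result (A B : Type) (m : timed A) (f : A -> timed B) :
  result (bind m f) = result (f (result m)).
Proof. by []. Qed.

Section LoopResults.

Variables A B : Type.

Lemma search_result (f : A -> timed bool) s :
  result (search f s) = has (fun x => result (f x)) s.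
Proof.
by elim: s => //= x s <-; rewrite /result /bind /=; case: (f x) => [[]].
Qed.

Lemma search2_result (f : A -> B -> timed bool) (g : A -> B) s :
  result (search2 f s (map g s)) = has (fun x => result (f x (g x))) s.
Proof.
by elim: s => //= x s <-; rewrite /result /bind /=; case: (f x (g x)) => [[]].
Qed.

Lemma select_result (f : A -> timed bool) s :
  result (select f s) = filter (fun x => result (f x)) s.
Proof. by elim: s => //= x s <-. Qed.

Lemma each_result (f : A -> timed B) s :
  result (each f s) = map (fun x => result (f x)) s.
Proof. by elim: s => //= x s <-. Qed.

Lemma lookup_result (d : A) s k : result (lookup d s k) = nth d s k.
Proof. by elim: s k => [|x s IH] [|k] //=; rewrite -IH. Qed.

Lemma or_rows_result (f g : A -> bool) s :
  result (or_rows (map f s) (map g s)) = map (fun x => f x || g x) s.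
Proof. by elim: s => //= x s <-. Qed.

End LoopResults.

(** * Warshall's transitive closure *)

Section Warshall.

Variables (A : eqType) (nodes : seq A).
Implicit Types (R : rel A) (t u p : A).

Definition adjacency R : seq (seq bool) :=
  [seq [seq R t u | u <- nodes] | t <- nodes].

(** One round of Warshall's algorithm with pivot [p], on relations. *)
Definition close R p : rel A := fun t u => R t u || R t p && R p u.

(** [size done] is a position of the pivot [p], so the lookups return its row and its column
    entries. *)
Lemma warshall_step_result R done p rest : nodes = done ++ p :: rest ->
  result (warshall_step (adjacency R) (size done)) = adjacency (close R p).
Proof.
move=> e; have nthp C (f : A -> C) d : nth d [seq f u | u <- nodes] (size done) = f p.
  by rewrite e map_cat nth_cat size_map ltnn subnn.
rewrite /warshall_step bind_result lookup_result nthp each_result -map_comp.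
apply: eq_map => t; rewrite [LHS]bind_result lookup_result nthp.
case h: (R t p) => /=; rewrite ?or_rows_result.
  by apply: eq_map => u; rewrite /close h.
by apply: eq_map => u; rewrite /close h orbF.
Qed.

Lemma warshall_result C (pivots : seq C) R done rest :
  size pivots = size rest -> nodes = done ++ rest ->
  result (warshall pivots (size done) (adjacency R)) =
  adjacency (foldl close R rest).
Proof.
elim: pivots rest done R => [|c pivots IH] [|p rest] // done R [sz] e.
rewrite [warshall _ _ _]/= bind_result (warshall_step_result R e).
rewrite -(size_rcons done p).
by apply: IH => //; rewrite cat_rcons.
Qed.

(** The loop invariant: composition through a pivot already treated stays inside [R]. *)
Definition transitive_at R p := forall t u, R t p -> R p u -> R t u.

Lemma close_transitive R p : transitive_at (close R p) p.
Proof.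
move=> t u; rewrite /close.
by case/orP => [->|/andP[-> _]]; case/orP => [->|/andP[_ ->]]; rewrite orbT.
Qed.

Lemma close_transitive_at R p q : transitive_at R q -> transitive_at (close R p) q.
Proof.
move=> tr t u; rewrite /close => /orP[tq|/andP[tp pq]] /orP[qu|/andP[qp pu]].
- by rewrite (tr t u).
- by rewrite (tr t p) // pu orbT.
- by rewrite tp (tr p u) // orbT.
- by rewrite tp pu orbT.
Qed.

Lemma foldl_close_transitive ps R p :
  p \in ps \/ transitive_at R p -> transitive_at (foldl close R ps) p.
Proof.
elim: ps R => [|q ps IH] R /=; first by case.
rewrite inE => h; apply: IH; case: h => [/orP[/eqP->|->]|]; [|by left|].
  by right; apply: close_transitive.
by right; apply: close_transitive_at.
Qed.

Lemma foldl_close_sub ps R t u : R t u -> foldl close R ps t u.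
Proof. by elim: ps R => //= p ps IH R h; apply: IH; rewrite /close h. Qed.

(** Each round adds only compositions through a node, which a transitive [Q] absorbs. *)
Lemma foldl_close_min ps R (Q : rel A) : transitive Q ->
  {subset ps <= nodes} -> {in nodes &, subrel R Q} ->
  {in nodes &, subrel (foldl close R ps) Q}.
Proof.
move=> trQ; elim: ps R => //= p ps IH R sub RQ.
have pn : p \in nodes by apply: sub; rewrite mem_head.
apply: IH => [q qs|t u tn un]; first by apply: sub; rewrite inE qs orbT.
case/orP => [|/andP[tp pu]]; first exact: RQ.
by apply: trQ (RQ t p _ _ tp) (RQ p u _ _ pu).
Qed.

End Warshall.

(** * What each phase of Algorithm 1 computes *)

Section AlgorithmResult.

Variables (S : schema) (T : seq (transaction S)).
Implicit Types (i j : txid T) (x y b : occ T) (t u : tx_data T).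

Definition tx_datum i : tx_data T := (i, tx_ops i).

Lemma mem_tx_ops i x : (x \in tx_ops i) = (tx x == i).
Proof.
apply/mapP/eqP => [[q _ ->]//|<-].
by exists (tagged x); rewrite ?mem_enum //; case: x.
Qed.

Lemma has_ww_result P Q : result (has_ww P Q : timed bool) =
  has (fun x : occ T => has (ww_conflict x) Q) P.
Proof. by rewrite search_result; apply: eq_has => x; rewrite search_result. Qed.

Lemma has_conflict_result P Q : result (has_conflict P Q : timed bool) =
  has (fun x : occ T => has (conflict x) Q) P.
Proof. by rewrite search_result; apply: eq_has => x; rewrite search_result. Qed.

Lemma pcf_nodes_result (b1 : occ T) :
  result (pcf_nodes b1 (tx_datum (tx b1)) (input T)) =
  [seq tx_datum i | i <- enum (pcf_node b1)].
Proof.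
rewrite /pcf_nodes bind_result !select_result /input filter_map; congr map.
(* The enumeration of a predicate is itself a filter of the full enumeration, so two filters are
   compared. *)
rewrite [in RHS]/enum_mem -enumT.
apply: eq_filter => i; rewrite [LHS]bind_result -[RHS]/(pcf_node b1 i) /pcf_node /=.
case: eqP => // d; rewrite bind_result has_ww_result -all_predC.
apply/allP/forallP => [h x|h x].
  apply/forallP => y; apply/implyP => /and3P[xi yi r].
  have := h x; rewrite mem_tx_ops => /(_ xi) /=; rewrite -all_predC => /allP; apply.
  by rewrite mem_filter /= r mem_tx_ops.
rewrite mem_tx_ops => xi /=; rewrite -all_predC; apply/allP => y.
rewrite mem_filter mem_tx_ops => /andP[r yi].
by have /forallP/(_ y)/implyP := h x; apply; rewrite xi yi.
Qed.

Definition linked t u : bool :=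
  (t.1 == u.1) || has (fun x => has (conflict x) u.2) t.2.

Lemma pcf_matrix_result (nodes : seq (tx_data T)) :
  result (pcf_matrix nodes) = adjacency nodes linked.
Proof.
rewrite each_result; apply: eq_map => t; rewrite each_result; apply: eq_map => u.
rewrite bind_result /linked /=; case: eqP => //= _.
by rewrite has_conflict_result.
Qed.

Lemma linked_datum i j : linked (tx_datum i) (tx_datum j) =
  (i == j) || [exists x, exists y, [&& tx x == i, tx y == j & conflict x y]].
Proof.
congr orb; apply/hasP/existsP => [[x]|[x /existsP[y /and3P[xi yj c]]]].
  rewrite mem_tx_ops => xi /hasP[y]; rewrite mem_tx_ops => yj c.
  by exists x; apply/existsP; exists y; rewrite xi yj.
by exists x; rewrite ?mem_tx_ops //; apply/hasP; exists y; rewrite ?mem_tx_ops.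
Qed.

(** Soundness is minimality against [connect]; for completeness, each inner node of a path has
    served as a pivot. *)
Lemma closure_connect (b1 : occ T) i j
    (nodes := [seq tx_datum i | i <- enum (pcf_node b1)]) :
  pcf_node b1 i -> pcf_node b1 j ->
  foldl (@close _) linked nodes (tx_datum i) (tx_datum j) =
  connect (pcf_edge b1) i j.
Proof.
move=> ni nj; have mem_nodes k : pcf_node b1 k -> tx_datum k \in nodes.
  by move=> nk; apply: map_f; rewrite mem_enum.
apply/idP/connectP => [h|[q pq ->]].
  apply/connectP.
  pose Q : rel (tx_data T) := fun t u => connect (pcf_edge b1) t.1 u.1.
  apply: (@foldl_close_min _ nodes nodes linked Q) h; rewrite ?mem_nodes //.
    by move=> t u v; apply: connect_trans.
  move=> t u /mapP[k + ->] /mapP[l + ->]; rewrite !mem_enum => nk nl.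
  rewrite linked_datum => /orP[/eqP->|h]; first exact: connect0.
  by apply: connect1; apply/and3P.
elim: q i ni pq => [|k q IH] i ni /=.
  by move=> _; apply: foldl_close_sub; rewrite linked_datum eqxx.
case/andP => /and3P[_ nk h] pq.
apply: (@foldl_close_transitive _ nodes _ (tx_datum k)).
- by left; apply: mem_nodes.
- by apply: foldl_close_sub; rewrite linked_datum h orbT.
- exact: IH.
Qed.

Lemma check_split_result (b1 : occ T) :
  result (check_split b1 (tx_datum (tx b1)) (input T)) =
  [exists a2, exists bm, exists a1,
    [&& pcf_node b1 (tx a2), pcf_node b1 (tx bm),
        connect (pcf_edge b1) (tx a2) (tx bm), tx a1 == tx b1 &
        [&& conflict a1 bm, rw_conflict b1 a2 &
            (rank b1 < rank a1) || rw_conflict bm a1]]].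
Proof.
rewrite /check_split bind_result pcf_nodes_result; set nodes := map _ _.
rewrite bind_result pcf_matrix_result bind_result.
rewrite (@warshall_result _ nodes _ nodes linked [::] nodes) //.
rewrite search2_result has_map.
(* The loops become nested [has]; afterwards T2 and Tm are recovered as [tx a2] and [tx bm]. *)
transitivity (has (fun i => has (fun j => connect (pcf_edge b1) i j &&
    has (fun a1 => has (fun a2 => has (fun bm =>
      [&& conflict a1 bm, rw_conflict b1 a2 &
            (rank b1 < rank a1) || rw_conflict bm a1])
      (tx_ops j)) (tx_ops i)) (tx_ops (tx b1))) (enum (pcf_node b1)))
    (enum (pcf_node b1))).
  apply: eq_in_has => i; rewrite mem_enum => ni /=.
  rewrite search2_result has_map; apply: eq_in_has => j; rewrite mem_enum => nj /=.
  rewrite closure_connect //; case: ifP => //= _; rewrite search_result.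
  apply: eq_has => a1; rewrite search_result; apply: eq_has => a2.
  by rewrite search_result; apply: eq_has.
apply/hasP/existsP => [[i]|[a2 /existsP[bm /existsP[a1]]]].
  rewrite mem_enum => ni /hasP[j]; rewrite mem_enum => nj /andP[ij].
  case/hasP => a1; rewrite mem_tx_ops => a1i.
  case/hasP => a2; rewrite mem_tx_ops => /eqP a2i.
  case/hasP => bm; rewrite mem_tx_ops => /eqP bmj h.
  exists a2; apply/existsP; exists bm; apply/existsP; exists a1.
  by rewrite a2i bmj a1i ij h !andbT; apply/andP.
case/and5P => n2 nm c a1i h; exists (tx a2); first by rewrite mem_enum.
apply/hasP; exists (tx bm); first by rewrite mem_enum.
rewrite c /=; apply/hasP; exists a1; first by rewrite mem_tx_ops.
apply/hasP; exists a2; first by rewrite mem_tx_ops.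
by apply/hasP; exists bm; first by rewrite mem_tx_ops.
Qed.

Lemma algorithm1_split_witness :
  result (algorithm1 T) = false <-> split_witness T.
Proof.
rewrite /algorithm1 bind_result search_result has_map.
set F := has _ _; suff h : F <-> split_witness T.
  by rewrite -h; case: (F) => /=; split.
split=> [/hasP[i _ /=]|[b1 [a1 [a2 [bm [ta1 n2 nm c h]]]]]].
  rewrite search_result => /hasP[b1]; rewrite mem_tx_ops => /eqP<-.
  rewrite bind_result /=; case: ifP => // _; rewrite -/(tx_datum _) check_split_result.
  case/existsP => a2 /existsP[bm /existsP[a1]].
  by case/and5P => n2 nm c /eqP ta1 h; exists b1, a1, a2, bm.
apply/hasP; exists (tx b1); first by rewrite mem_enum.
rewrite /= search_result; apply/hasP; exists b1; first by rewrite mem_tx_ops.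
have rb1 : is_read b1 by case/and3P: h => _ /rw_conflictP[].
rewrite bind_result /= rb1 -/(tx_datum _) check_split_result.
apply/existsP; exists a2; apply/existsP; exists bm; apply/existsP; exists a1.
by rewrite n2 nm c ta1 eqxx.
Qed.

Lemma algorithm1_correct : result (algorithm1 T) = true <-> robust_against_RC T.
Proof.
case h: (result (algorithm1 T)); split=> //.
  move=> _ s rc; apply: acyclic_serializable => i j ij; apply/negP => ji.
  by have := cyclic_split_witness rc ij ji; rewrite -algorithm1_split_witness h.
move=> robust; have /split_witness_not_serializable[s [rc ns]] :=
  iffLR algorithm1_split_witness h.
by case: ns; apply: robust.
Qed.

End AlgorithmResult.

(** * Cost of the algorithm *)

Lemma leq_sum_seq (I : eqType) (s : seq I) (f g : I -> nat) :
  {in s, forall x, f x <= g x} -> \sum_(x <- s) f x <= \sum_(x <- s) g x.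
Proof. by move=> h; rewrite big_seq [leqRHS]big_seq; apply: leq_sum. Qed.

Lemma cost_bind (A B : Type) (m : timed A) (f : A -> timed B) :
  cost (bind m f) = (cost m + cost (f (result m))).+1.
Proof. by []. Qed.

Section LoopCosts.

Variables A B : Type.

Lemma search_cost (f : A -> timed bool) s :
  cost (search f s) <= (\sum_(x <- s) (cost (f x)).+1).+1.
Proof.
elim: s => [|x s IH]; first by rewrite big_nil.
rewrite big_cons [search _ _]/= cost_bind; case: ifP => _ /=; lia.
Qed.

Lemma search2_cost (f : A -> B -> timed bool) (g : A -> nat) s t :
  (forall x y, cost (f x y) <= g x) ->
  cost (search2 f s t) <= (\sum_(x <- s) (g x).+1).+1.
Proof.
move=> fg; elim: s t => [|x s IH] [|y t]; rewrite ?big_nil //.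
rewrite big_cons [search2 _ _ _]/= cost_bind; have := fg x y; have := IH t.
case: ifP => _ /=; lia.
Qed.

(** Two binds and one [ret] per element account for the three extra units. *)
Lemma select_cost (f : A -> timed bool) s :
  cost (select f s) <= (\sum_(x <- s) (cost (f x)).+3).+1.
Proof.
elim: s => [|x s IH]; first by rewrite big_nil.
rewrite big_cons [select _ _]/= !cost_bind /=; lia.
Qed.

Lemma each_cost (f : A -> timed B) s :
  cost (each f s) <= (\sum_(x <- s) (cost (f x)).+3).+1.
Proof.
elim: s => [|x s IH]; first by rewrite big_nil.
rewrite big_cons [each _ _]/= !cost_bind /=; lia.
Qed.

Lemma lookup_cost (d : A) s k : cost (lookup d s k) <= (size s).*2.+1.
Proof.
elim: s k => [|x s IH] [|k] //; rewrite [lookup _ _ _]/= cost_bind /=.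
by have := IH k; lia.
Qed.

End LoopCosts.

Lemma sum_const_seq (A : Type) (s : seq A) c : \sum_(x <- s) c = size s * c.
Proof. by rewrite big_const_seq count_predT iter_addn_0 mulnC. Qed.

Lemma or_rows_cost r q : cost (or_rows r q) <= (size r).*2.+1.
Proof.
elim: r q => [|a r IH] [|b q] //; rewrite [or_rows _ _]/= cost_bind /=.
by have := IH q; lia.
Qed.

Lemma or_rows_size r q : size (result (or_rows r q)) <= size r.
Proof.
elim: r q => [|a r IH] [|b q] //; rewrite [or_rows _ _]/= bind_result /=.
by rewrite ltnS.
Qed.

(** * Cubic cost of the transitive closure *)

Section WarshallCost.

Variable n : nat.
Hypothesis n_gt0 : 0 < n.

Definition fits (M : seq (seq bool)) : bool :=
  (size M <= n) && all (fun r => size r <= n) M.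

Lemma warshall_step_fits M k : fits M -> fits (result (warshall_step M k)).
Proof.
case/andP => sM /allP rM; rewrite /warshall_step bind_result each_result.
apply/andP; split; first by rewrite size_map.
apply/allP => _ /mapP[r /rM rn ->]; rewrite bind_result.
by case: ifP => _ //; apply: leq_trans (or_rows_size _ _) rn.
Qed.

Lemma warshall_step_cost M k : fits M -> cost (warshall_step M k) <= 15 * n ^ 2.
Proof.
case/andP => sM /allP rM; rewrite /warshall_step cost_bind.
(* Per row: a lookup and an [or_rows] of at most 2n+1 each, a bind, and three units of [each]. The
   step then costs at most 4n^2 + 8n + 3. *)
set e := each _ _; have he : cost e <= (size M * (4 * n + 6)).+1.
  apply: leq_trans (each_cost _ _) _; rewrite ltnS -sum_const_seq.
  apply: leq_sum_seq => r /rM rn; rewrite cost_bind.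
  have := lookup_cost false r k; case: ifP => _ /=; last by lia.
  have := or_rows_cost r (result (lookup [::] M k)); lia.
have := lookup_cost [::] M k; have : size M * (4 * n + 6) <= n * (4 * n + 6).
  by rewrite leq_mul2r sM orbT.
have : n <= n * n by rewrite leq_pmulr.
rewrite -mulnn; nia.
Qed.

Lemma warshall_cost (A : Type) (pivots : seq A) k M : fits M ->
  cost (warshall pivots k M) <= (size pivots * (15 * n ^ 2).+1).+1.
Proof.
elim: pivots k M => // a pivots IH k M fM.
rewrite -[cost _]/(cost (warshall_step M k) +
  cost (warshall pivots k.+1 (result (warshall_step M k)))).+1 [size _]/= mulSn.
have := IH k.+1 _ (warshall_step_fits k fM).
have := warshall_step_cost k fM; lia.
Qed.

End WarshallCost.

(** * Cost of the phases and of the whole algorithm *)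

Section AlgorithmCost.

Variables (S : schema) (T : seq (transaction S)).
Hypothesis T_gt0 : 0 < size T.
Implicit Types (i j : txid T) (x y b : occ T) (t u : tx_data T).

Let k := num_ops T.
Let l := max_ops T.
Let n := size T.

(** The extra one is the commit, so the weights of the input sum to [k]; it also absorbs the
    constant cost of a loop. *)
Definition weight t : nat := (size t.2).+1.

Lemma tx_ops_size i : size (tx_ops i) = size (actions (tnth (in_tuple T) i)).
Proof. by rewrite size_map -cardE card_ord. Qed.

Lemma input_size : size (input T) = n.
Proof. by rewrite size_map -cardE card_ord. Qed.

Lemma input_weight : \sum_(t <- input T) weight t = k.
Proof.
rewrite big_map big_enum /= /k /num_ops (big_tnth _ _ T).
by apply: eq_bigr => i _; rewrite /weight tx_ops_size.
Qed.

Lemma weight_le t : t \in input T -> weight t <= l.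
Proof.
case/mapP => i _ ->; rewrite /weight tx_ops_size /l /max_ops.
rewrite (big_tnth _ _ T).
exact: (@leq_bigmax _ (fun i => (size (actions (tnth (in_tuple T) i))).+1)).
Qed.

Lemma size_le_weight (ts : seq (tx_data T)) : size ts <= \sum_(t <- ts) weight t.
Proof. by rewrite -[size ts]muln1 -sum_const_seq; apply: leq_sum_seq. Qed.

Lemma num_ops_gt0 : 0 < k.
Proof.
rewrite -input_weight; apply: leq_trans (size_le_weight _).
by rewrite input_size.
Qed.

Lemma pair_search_cost (f : occ T -> occ T -> timed bool) P Q :
  (forall x y, cost (f x y) = 1) ->
  cost (search (fun x => search (f x) Q) P) <= 2 * ((size P).+1 * (size Q).+1).
Proof.
move=> f1; have inner x : cost (search (f x) Q) <= (size Q * 2).+1.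
  apply: leq_trans (search_cost _ _) _; rewrite ltnS -sum_const_seq.
  by apply: leq_sum => y _; rewrite f1.
apply: leq_trans (search_cost _ _) _.
apply: (@leq_trans (\sum_(x <- P) (size Q * 2).+2).+1).
  by rewrite ltnS; apply: leq_sum => x _; rewrite ltnS.
rewrite sum_const_seq; nia.
Qed.

Lemma has_ww_cost (P Q : seq (occ T)) :
  cost (has_ww P Q) <= 2 * ((size P).+1 * (size Q).+1).
Proof. exact: pair_search_cost. Qed.

Lemma has_conflict_cost (P Q : seq (occ T)) :
  cost (has_conflict P Q) <= 2 * ((size P).+1 * (size Q).+1).
Proof. exact: pair_search_cost. Qed.

(** Every transaction is compared with a prefix shorter than [l]; summing the weights gives the
    factor [k]. *)
Lemma pcf_nodes_cost b t : weight t <= l ->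
  cost (pcf_nodes b t (input T)) <= 15 * (k * l).
Proof.
move=> tl; rewrite /pcf_nodes cost_bind select_result.
set prefix := filter _ _.
have prefix_size : size prefix <= size t.2 by rewrite size_filter count_size.
have c1 : cost (select (fun x => test_before_eq x b) t.2) <= (size t.2 * 4).+1.
  by apply: leq_trans (select_cost _ _) _; rewrite /= sum_const_seq.
set c2 := cost (select _ (input T)).
have : c2 <= (\sum_(u <- input T) weight u * (9 * l)).+1.
  apply: leq_trans (select_cost _ _) _; rewrite ltnS; apply: leq_sum => u _.
  have := has_ww_cost u.2 prefix; rewrite cost_bind [cost (test_same _ _)]/=.
  case: ifP => _; rewrite ?cost_bind [cost (ret _)]/= /weight in tl *; nia.
rewrite -big_distrl /= input_weight; have := size_le_weight (input T).
rewrite input_size input_weight /n; rewrite /weight in tl; nia.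
Qed.

Section Nodes.

Variable nodes : seq (tx_data T).
Hypothesis sub : subseq nodes (input T).

Lemma nodes_size : size nodes <= n.
Proof. by rewrite -input_size size_subseq. Qed.

Lemma nodes_weight : \sum_(t <- nodes) weight t <= k.
Proof.
rewrite -input_weight; elim: (input T) nodes sub => [|u ts IH] [|v vs] //=.
  by rewrite big_nil.
case: eqP => [->|_] h; rewrite [leqRHS]big_cons.
  by rewrite big_cons leq_add2l; apply: IH.
exact: leq_trans (IH _ h) (leq_addl _ _).
Qed.

Lemma pcf_matrix_fits : fits n (result (pcf_matrix nodes)).
Proof.
rewrite each_result; apply/andP; split; first by rewrite size_map nodes_size.
by apply/allP => _ /mapP[t _ ->]; rewrite each_result size_map nodes_size.
Qed.

(** An entry costs about the product of two weights; over all pairs these sum to at most k^2. *)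
Lemma pcf_matrix_cost : cost (pcf_matrix nodes) <= 12 * k ^ 2.
Proof.
have k_gt0 := num_ops_gt0; apply: leq_trans (each_cost _ _) _.
apply: (@leq_trans (\sum_(t <- nodes) weight t * (11 * k)).+1); last first.
  by rewrite -big_distrl /=; have := nodes_weight; nia.
rewrite ltnS; apply: leq_sum => t _.
set c := cost _; suff : c <= (weight t * (7 * k)).+1.
  by clearbody c; rewrite /weight; nia.
apply: leq_trans (each_cost _ _) _; rewrite ltnS.
apply: (@leq_trans (\sum_(u <- nodes) weight u * (7 * weight t))); last first.
  by rewrite -big_distrl /=; have := nodes_weight; nia.
apply: leq_sum => u _; have := has_conflict_cost t.2 u.2.
rewrite cost_bind [cost (test_same _ _)]/=.
by rewrite /weight; case: ifP => _; first rewrite [cost (ret _)]/=; nia.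
Qed.

Lemma check_ops_search_cost b t t2 tm :
  cost (search (fun a1 => search (fun a2 => search (fun bm =>
    check_ops b a1 a2 bm) tm.2) t2.2) t.2) <=
  10 * (weight t * (weight t2 * weight tm)).
Proof.
(* [check_ops] takes four tests, four binds and a [ret]; the loop adds one unit. *)
have c3 a1 a2 : cost (search (fun bm => check_ops b a1 a2 bm) tm.2) <=
    (size tm.2 * 10).+1.
  by apply: leq_trans (search_cost _ _) _; rewrite /= sum_const_seq.
have c2 a1 : cost (search (fun a2 => search (fun bm =>
    check_ops b a1 a2 bm) tm.2) t2.2) <= (size t2.2 * (size tm.2 * 10).+2).+1.
  apply: leq_trans (search_cost _ _) _; rewrite ltnS -sum_const_seq.
  by apply: leq_sum => a2 _; rewrite ltnS.
apply: leq_trans (search_cost _ _) _.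
apply: (@leq_trans (size t.2 * (size t2.2 * (size tm.2 * 10).+2).+2).+1).
  by rewrite ltnS -sum_const_seq; apply: leq_sum => a1 _; rewrite ltnS.
rewrite /weight; move: (size t.2) (size t2.2) (size tm.2) => x y z.
have : (y * (z * 10).+2).+2 <= 10 * (y.+1 * z.+1) by nia.
move: (y.+1 * z.+1) (y.+1 * z.+1) => u v; nia.
Qed.

(** [a1] ranges over one transaction, giving [l], while [a2] and [bm] range over all nodes, giving
    k^2. *)
Lemma pairs_cost b t M : weight t <= l ->
  cost (search2 (fun t2 row => search2 (fun tm (reach : bool) =>
      if reach then
        search (fun a1 => search (fun a2 => search (fun bm =>
          check_ops b a1 a2 bm) tm.2) t2.2) t.2
      else ret false) nodes row) nodes M) <= 14 * (k ^ 2 * l).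
Proof.
move=> tl; have sub_k : \sum_(u <- nodes) weight u <= k := nodes_weight.
have k_gt0 := num_ops_gt0.
apply: leq_trans (search2_cost (g := fun t2 => weight t2 * (12 * (l * k))) _ _ _) _.
  move=> t2 row; apply: leq_trans (search2_cost
    (g := fun tm => weight tm * (10 * (weight t * weight t2))) _ _ _) _.
    move=> tm [|]; last by rewrite [cost _]/= /weight; nia.
    by apply: leq_trans (check_ops_search_cost _ _ _ _) _; nia.
  apply: (@leq_trans (\sum_(tm <- nodes)
      weight tm * (11 * (weight t * weight t2))).+1).
    by rewrite ltnS; apply: leq_sum => tm _; rewrite /weight; nia.
  rewrite -big_distrl /= (@leq_ltn_trans (k * (11 * (l * weight t2)))) //.
    by rewrite leq_mul // leq_mul2l /= leq_mul2r tl orbT.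
  by rewrite /weight in tl *; nia.
apply: (@leq_trans (\sum_(t2 <- nodes) weight t2 * (13 * (l * k))).+1).
  by rewrite ltnS; apply: leq_sum => t2 _; rewrite /weight in tl *; nia.
rewrite -big_distrl /=; have : (\sum_(u <- nodes) weight u) * (13 * (l * k)) <=
  k * (13 * (l * k)) by rewrite leq_mul2r sub_k orbT.
by rewrite /weight in tl *; rewrite -mulnn; nia.
Qed.

End Nodes.

Lemma check_split_cost b t : weight t <= l ->
  cost (check_split b t (input T)) <= 44 * (k ^ 2 * l) + 17 * n ^ 3.
Proof.
move=> tl; have k_gt0 := num_ops_gt0; rewrite /check_split cost_bind.
have sub : subseq (result (pcf_nodes b t (input T))) (input T).
  by rewrite /pcf_nodes bind_result !select_result; apply: filter_subseq.
move: (result _) sub (pcf_nodes_cost b tl) => nodes sub c1.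
rewrite cost_bind; have c2 := pcf_matrix_cost sub.
rewrite cost_bind; have c3 := warshall_cost T_gt0 nodes 0 (pcf_matrix_fits sub).
have c4 := pairs_cost sub b
  (result (warshall nodes 0 (result (pcf_matrix nodes)))) tl.
have : size nodes * (15 * n ^ 2).+1 <= n * (15 * n ^ 2).+1.
  by rewrite leq_mul2r nodes_size.
move: (cost (search2 _ _ _)) (cost (warshall _ _ _)) (cost (pcf_matrix _))
  (cost (pcf_nodes _ _ _)) c1 c2 c3 c4 => v1 v2 v3 v4 c1 c2 c3 c4.
have : 0 < n by []. rewrite /weight in tl.
have : k * l <= k ^ 2 * l by rewrite -mulnn; nia.
have : k ^ 2 <= k ^ 2 * l by nia.
have -> : n ^ 3 = n * n ^ 2 by rewrite expnS.
(* The phases give 15 + 12 + 14, and three binds make 44; the closure costs at most 15n^3 + n + 1,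
   below 17n^3. *)
rewrite -(mulnn n) -(mulnn k); nia.
Qed.

(** [check_split] runs at most once per operation, which multiplies its cost by [k]. *)
Lemma algorithm1_cost :
  cost (algorithm1 T) <= 70 * maxn (k * n ^ 3) (k ^ 3 * l).
Proof.
have k_gt0 := num_ops_gt0; have n_gt0 : 0 < n := T_gt0.
have l_gt0 : 0 < l.
  move: n_gt0; rewrite -input_size; case e: (input T) => [//|t ts] _.
  by apply: (@leq_trans (weight t)) => //; apply: weight_le; rewrite e mem_head.
(* The coefficient 50 leaves six units above the 44 of [check_split_cost] for the surrounding
   loops. *)
pose X := 50 * (k ^ 2 * l) + 17 * n ^ 3.
have body t b : weight t <= l ->
    (cost (let! r := test_read b in
      if r then check_split b t (input T) else ret false)).+3 <= X.
  move=> tl; have := check_split_cost b tl; rewrite cost_bind [cost (test_read _)]/=.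
  have : 0 < k ^ 2 * l by rewrite muln_gt0 expn_gt0 k_gt0 l_gt0.
  by rewrite /X; case: ifP => _; last rewrite [cost (ret _)]/=; lia.
have row t : t \in input T -> (cost (search (fun b => let! r := test_read b in
      if r then check_split b t (input T) else ret false) t.2)).+1 <= weight t * X.
  move/weight_le => tl; rewrite /weight mulSn addnC.
  apply: leq_ltn_trans (search_cost _ _) _.
  have : \sum_(b <- t.2) (cost (let! r := test_read b in
      if r then check_split b t (input T) else ret false)).+1 <= size t.2 * X.
    rewrite -sum_const_seq; apply: leq_sum => b _.
    by apply: leq_trans (body t b tl); rewrite ltnS leqW.
  have : 0 < k ^ 2 * l by rewrite muln_gt0 expn_gt0 k_gt0 l_gt0.
  move: (\sum_(b <- _) _) (size _ * _); rewrite /X; lia.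
rewrite /algorithm1 cost_bind [cost (ret _)]/=.
set c := cost _; have : c <= (\sum_(t <- input T) weight t * X).+1.
  apply: leq_trans (search_cost _ _) _; rewrite ltnS.
  exact: leq_sum_seq.
rewrite -big_distrl /= input_weight; clearbody c.
have : 0 < k ^ 3 * l by rewrite muln_gt0 expn_gt0 k_gt0 l_gt0.
have -> : k * X = 50 * (k ^ 3 * l) + 17 * (k * n ^ 3)
  by rewrite /X (expnS k 2) mulnDr !(mulnCA k) !mulnA.
(* 70 is 50 + 17 plus three units for the end of the loop, the last bind and the last [ret]. *)
move: (k ^ 3 * l) (k * n ^ 3) => u v; lia.
Qed.

End AlgorithmCost.

Theorem theorem8 :
  (forall (S : schema) (T : seq (transaction S)),
     result (algorithm1 T) = true <-> robust_against_RC T) /\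
  (exists c : nat, forall (S : schema) (T : seq (transaction S)),
     (0 < size T)%N ->
     (cost (algorithm1 T) <=
        c * maxn (num_ops T * size T ^ 3) (num_ops T ^ 3 * max_ops T))%N).
Proof.
split; first exact: algorithm1_correct.
by exists 70 => S T; apply: algorithm1_cost.
Qed.
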